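(* Let $f=\sum_{i+j+k=6}c_{ijk}x^iy^jz^k$ be the general ternary sextic, with $28$ unknown coefficients $c_{ijk}$. The discriminant $\Delta$ of ternary sextics equals the determinant of the $45\times 45$ Sylvester matrix $\mathcal{S}_f$.
   Context: The discriminant is the irreducible hypersurface of degree $75$ in the projective space $\mathbb{P}^{27}$ of plane sextic curves whose points are the singular curves. It is identified with its defining irreducible polynomial $\Delta$ over $\mathbb{Z}$ in the $28$ unknowns $c_{ijk}$. The Sylvester matrix $\mathcal{S}_f$ is the representation in monomial bases of the $\mathbb{R}$-linear map $$\mathcal{S}_f:\ (\mathbb{R}[x,y,z]_3)^3\oplus\mathbb{R}[x,y,z]_4\ \longrightarrow\ \mathbb{R}[x,y,z]_8$$ defined as follows, where $\mathbb{R}[x,y,z]_m$ denotes the space of ternary forms of degree $m$. On the first summand, a triple of cubics is mapped to an octic via $(a,b,c)\mapsto a\frac{\partial f}{\partial x}+b\frac{\partial f}{\partial y}+c\frac{\partial f}{\partial z}$. On the second summand, a quartic monomial $x^ry^sz^t$ (with $r+s+t=4$) is mapped to the octic $\det(M_{rst})$, where $M_{rst}$ is any $3\times 3$ matrix of ternary forms that satisfies the homogeneous identity $$\begin{pmatrix}\partial f/\partial x\\ \partial f/\partial y\\ \partial f/\partial z\end{pmatrix}=M_{rst}\cdot\begin{pmatrix}x^{r+1}\\ y^{s+1}\\ z^{t+1}\end{pmatrix}.$$ The entries of $M_{rst}$ are linear in the $c_{ijk}$, so $\det(M_{rst})$ is an octic in $x,y,z$ whose coefficients are cubics in the $c_{ijk}$;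 these coefficients are the entries of the column of $\mathcal{S}_f$ indexed by $x^ry^sz^t$.
   Formalization: The determinant of the Sylvester matrix is shown to equal ±6^21 times the irreducible integer polynomial Δ, not Δ itself; literal equality fails, e.g. for the Fermat sextic the determinant is ±6^75 while Δ is ±6^54. *)

(* Defs.v *)
From HB Require Import structures.
From mathcomp Require Import all_boot all_order all_algebra.
From mathcomp Require Import reals complex mpoly.

Set Implicit Arguments.
Unset Strict Implicit.
Unset Printing Implicit Defensive.

Import GRing.Theory.
Local Open Scope ring_scope.

(* The multi-index (r, s, t), i.e. the exponent of x^r y^s z^t. *)
Definition mon3 (r s t : nat) : 'X_{1..3} := Multinom [tuple r; s; t].

(* The monomial basis of the ternary forms of degree d, in a fixed order;
   another order only changes the sign of a determinant. *)
Definition monoms (d : nat) : seq 'X_{1..3} :=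
  [seq mon3 r s (d - r - s) | r <- iota 0 d.+1, s <- iota 0 (d - r).+1].

Lemma size_monoms3 : size (monoms 3) = 10%N. Proof. by []. Qed.
Lemma size_monoms4 : size (monoms 4) = 15%N. Proof. by []. Qed.
Lemma size_monoms6 : size (monoms 6) = 28%N. Proof. by []. Qed.
Lemma size_monoms8 : size (monoms 8) = 45%N. Proof. by []. Qed.

Lemma mem_monoms (d : nat) (m : 'X_{1..3}) : (m \in monoms d) = (mdeg m == d).
Proof.
have degE r s t : mdeg (mon3 r s t) = (r + s + t)%N.
  by rewrite mdegE !big_ord_recr big_ord0.
apply/allpairsPdep/eqP => [[r [s [r_d s_d ->]]] | <-].
  rewrite !mem_iota !ltnS in r_d s_d.
  by rewrite degE -addnA subnKC // subnKC.
have mE : mon3 (m 0%R) (m 1%R) (m 2%R) = m.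
  apply/mnmP => i; rewrite [LHS](tnth_nth 0%N).
  by case: i => [[|[|[|]]] // lt_i3] /=; congr (m _); apply: val_inj.
have -> : mdeg m = (m 0%R + (m 1%R + m 2%R))%N by rewrite -{1}mE degE addnA.
by exists (m 0%R), (m 1%R); rewrite !mem_iota !ltnS !addKn mE !leq_addr.
Qed.

Lemma uniq_monoms (d : nat) : uniq (monoms d).
Proof.
apply: allpairs_uniq_dep => [|r _|]; rewrite ?iota_uniq //.
move=> [r s] [r' s'] _ _ /= [] -> ->; by [].
Qed.

Section Sextics.
Variable A : comNzRingType.

Definition sextic (c : 'I_28 -> A) : {mpoly A[3]} :=
  \sum_(k < 28) c k *: 'X_[nth 0%MM (monoms 6) k].

(* Singularity of the plane curve f = 0 at a point of the projective plane. *)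
Definition singular_curve (f : {mpoly A[3]}) : Prop :=
  exists p : 'I_3 -> A,
    [/\ exists i, p i != 0, f.@[p] = 0 & forall i, (f^`M(i)).@[p] = 0].

(* M is a possible choice of M_rst, for m = (r, s, t) of degree 4: homogeneity
   of the identity forces the entries of its j-th column to be forms of degree
   5 - (m_j + 1) = 4 - m_j. *)
Definition admissible (f : {mpoly A[3]}) (m : 'X_{1..3})
    (M : 'M[{mpoly A[3]}]_3) : Prop :=
  (forall i j, M i j \is (4 - m j)%N.-homog) /\
  \col_i f^`M(i) = M *m \col_j 'X_j ^+ (m j).+1.

(* The linear map S_f on pairs (triple of cubics, quartic), where M provides
   the matrix M_rst at every multi-index of degree 4. *)
Definition sylvester_map (f : {mpoly A[3]}) (M : 'X_{1..3} -> 'M[{mpoly A[3]}]_3)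
    (u : 'rV[{mpoly A[3]}]_3 * {mpoly A[3]}) : {mpoly A[3]} :=
  \sum_i u.1 0 i * f^`M(i) + \sum_(m <- monoms 4) u.2@_m *: \det (M m).

Definition sylvester_basis : seq ('rV[{mpoly A[3]}]_3 * {mpoly A[3]}) :=
  [seq ('X_[m] *: delta_mx 0 i, 0) | i <- enum 'I_3, m <- monoms 3]
    ++ [seq (0, 'X_[m]) | m <- monoms 4].

Lemma size_sylvester_basis : size sylvester_basis = 45%N.
Proof. by rewrite size_cat size_allpairs size_enum_ord size_map. Qed.

Definition sylvester_matrix (f : {mpoly A[3]})
    (M : 'X_{1..3} -> 'M[{mpoly A[3]}]_3) : 'M[A]_45 :=
  \matrix_(i, j)
    (sylvester_map f M (nth 0 sylvester_basis j))@_(nth 0%MM (monoms 8) i).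

End Sextics.

Definition general_sextic (R : comNzRingType) : {mpoly {mpoly R[28]}[3]} :=
  sextic (fun k : 'I_28 => 'X_k : {mpoly R[28]}).

Definition irreducible_elt (A : idomainType) (p : A) : Prop :=
  [/\ p != 0, p \isn't a GRing.unit &
      forall a b, p = a * b -> a \is a GRing.unit \/ b \is a GRing.unit].

(* D is a defining polynomial, irreducible over the integers, of the
   hypersurface of degree 75 formed by the singular curves in the projective
   space of complex plane sextics. This determines D up to sign. *)
Definition is_discriminant (R : realType) (D : {mpoly int[28]}) : Prop :=
  [/\ irreducible_elt D, D \is 75.-homog &
      forall c : 'I_28 -> R[i], (exists k, c k != 0) ->
        (map_mpoly intr D).@[c] = 0 <-> singular_curve (sextic c)].

(* Main.v *)
(* For a sextic f over any commutative ring, let d(f) be the determinant of the Sylvester matrix.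
   Two matrices M_rst for the same monomial differ by syzygies of the regular sequence x^(r+1),
   y^(s+1), z^(t+1), so by exactness of the Koszul complex their determinants differ by an element
   of the Jacobian ideal. Hence d(f) does not depend on the choices and is compatible with ring
   homomorphisms, so that it comes from a polynomial d over the integers, homogeneous of degree 75.
   The Euler identity x f_x + y f_y + z f_z = 6 f makes 21 columns vanish modulo 6 after column
   operations: six relations between the first 30 columns, and the last 15 columns, because
   modulo 6 the determinant of M_rst lies in the Jacobian ideal. Thus d = 6^21 E.
   At a singular sextic all the octics in the image vanish at the singular point, so E vanishes
   wherever D does. As D is irreducible and Z[c] is factorial, a Bezout identity in one variable
   gives D | E, and the quotient is an integer k since both degrees are 75. Finally
   d(x^6 + y^6 + z^6) = +-6^75 and d(x^5 y + y^5 z + z^6) = +-6^21 5^45, so k divides 6^54 and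
   5^45, i.e. k = +-1. *)
Require Import Defs.
From HB Require Import structures.
From mathcomp Require Import all_boot all_order all_algebra.
From mathcomp Require Import perm boolp reals complex mpoly zify ring.

Set Implicit Arguments.
Unset Strict Implicit.
Unset Printing Implicit Defensive.

Import GRing.Theory.
Local Open Scope ring_scope.

(** * Factorial domains and Gauss lemma *)

(* The norm N is only required to be superadditive: for the integers it is log2 |a| rounded down,
   for polynomials the degree plus the norm of the leading coefficient. *)
Definition factorial_domain (A : idomainType) : Prop :=
  (exists N : A -> nat,
     (forall a b, a * b != 0 -> (N a + N b <= N (a * b)%R)%N) /\
     (forall a : A, a != 0 -> N a = 0%N -> a \is a GRing.unit)) /\
  (forall p : A, irreducible_elt p -> forall a b q, a * b = q * p ->
     (exists r, a = r * p) \/ (exists r, b = r * p)).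

Lemma not_irreducible_split (A : idomainType) (a : A) :
  a != 0 -> a \isn't a GRing.unit -> ~ irreducible_elt a ->
  exists b c, [/\ a = b * c, b \isn't a GRing.unit & c \isn't a GRing.unit].
Proof.
move=> a0 aU nirr; apply: contrapT => H; apply: nirr; split=> // b c abc.
have [|bU] := boolP (b \is a GRing.unit); first by left.
have [|cU] := boolP (c \is a GRing.unit); first by right.
by case: H; exists b, c.
Qed.

(** Both inductions are on the norm: by superadditivity, and since nonunits have positive norm,
    removing a nonunit factor strictly decreases it. The inner induction finds an irreducible
    divisor, the outer one strips it off. *)
Lemma factorial_ind (A : idomainType) (P : A -> Prop) : factorial_domain A ->
  (forall u, u \is a GRing.unit -> P u) ->
  (forall p a : A, irreducible_elt p -> a != 0 -> P a -> P (p * a)) ->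
  forall a : A, a != 0 -> P a.
Proof.
case=> -[N [NM N0]] _ Pu Pirr a.
have posN (b : A) : b != 0 -> b \isn't a GRing.unit -> (0 < N b)%N.
  move=> b0 bU; rewrite lt0n; apply: contra bU => /eqP; exact: N0.
have irr_dvd (b : A) : b != 0 -> b \isn't a GRing.unit ->
    exists p c, irreducible_elt p /\ b = p * c.
  elim: {b}(N b).+1 {-2}b (ltnSn (N b)) => // k IH b Nb b0 bU.
  have [irr|nirr] := pselect (irreducible_elt b); first by exists b, 1; rewrite mulr1.
  have [c [d [bE cU dU]]] := not_irreducible_split b0 bU nirr.
  have := b0; rewrite bE mulf_eq0 negb_or => /andP[c0 d0].
  have Nc : (N c < k)%N.
    apply: leq_trans (_ : N c + N d <= _)%N; first by rewrite -addn1 leq_add2l posN.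
    by rewrite (leq_trans (NM _ _ _)) -?bE.
  have [p [e [pirr cE]]] := IH c Nc c0 cU.
  exists p, (e * d); split=> //. by rewrite mulrA -cE.
elim: {a}(N a).+1 {-2}a (ltnSn (N a)) => // k IH a Na a0.
have [|aU] := boolP (a \is a GRing.unit); first exact: Pu.
have [p [b [pirr aE]]] := irr_dvd a a0 aU.
have := a0; rewrite aE mulf_eq0 negb_or => /andP[p0 b0].
apply: Pirr => //; apply: IH => //.
have [_ pU _] := pirr.
apply: leq_trans (_ : N p + N b <= _)%N; first by rewrite -add1n leq_add2r posN.
by rewrite (leq_trans (NM _ _ _)) -?aE.
Qed.

Section Gauss.
Variables (A : idomainType) (A_fact : factorial_domain A).
Implicit Types (f g h : {poly A}) (c p : A).

Lemma polyscaleI c : c != 0 -> injective (fun f => c *: f).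
Proof.
by move=> c0 f g; rewrite -!mul_polyC; apply: mulfI; rewrite polyC_eq0.
Qed.

Lemma polyC_dvdP p f : (forall i, exists r, f`_i = p * r) -> exists g, f = p *: g.
Proof.
move=> /choice[r rE]; exists (\poly_(i < size f) r i).
apply/polyP => i; rewrite coefZ coef_poly; case: ltnP => [_|fi]; first exact: rE.
by rewrite mulr0 nth_default.
Qed.

(** Take the least [i] and [j] at which [f] and [g] have a coefficient not divisible by [p]: modulo
    [p], the coefficient of [f * g] at [i + j] is the product of these two, and [p] is prime in
    [A]. *)
Lemma gauss_prime p f g h : irreducible_elt p -> f * g = p *: h ->
  (exists f', f = p *: f') \/ (exists g', g = p *: g').
Proof.
move=> pirr fgh; apply: contrapT => /not_orP[nf ng].
pose bad (u : {poly A}) := fun i : nat => `[< ~ exists r, u`_i = p * r >].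
have badex u : ~ (exists u', u = p *: u') -> exists i, bad u i.
  move=> nu; apply: contrapT => Hn; apply: nu; apply: polyC_dvdP => i.
  by apply: contrapT => Hi; apply: Hn; exists i; apply/asboolP.
have [i /asboolP fi fmin] := ex_minnP (badex _ nf).
have [j /asboolP gj gmin] := ex_minnP (badex _ ng).
have dvdlt u k m : (forall n, bad u n -> (m <= n)%N) -> (k < m)%N ->
    exists r, u`_k = p * r.
  move=> um km; apply: contrapT => Hk; have := um k (introT (asboolP _) Hk).
  by rewrite leqNgt km.
have: exists r, f`_i * g`_j = p * r.
  have := congr1 (fun q : {poly A} => q`_(i + j)) fgh.
  rewrite coefM coefZ (bigD1 (inord i)) //= inordK ?ltnS ?leq_addr // addKn.
  set s := \sum_(_ < _ | _) _ => eqs.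
  have [r sE] : exists r, s = p * r.
    rewrite /s; apply: (big_ind (fun x => exists r, x = p * r)).
    - by exists 0; rewrite mulr0.
    - by move=> x y [r ->] [t ->]; exists (r + t); rewrite mulrDr.
    move=> k; rewrite -val_eqE /= inordK ?ltnS ?leq_addr // => ki.
    have [lt_ki|le_ik] := ltnP k i.
      by have [r ->] := dvdlt _ _ _ fmin lt_ki; exists (r * g`_(i + j - k)); rewrite mulrA.
    have lt_kj : (i + j - k < j)%N.
      have lt_ik : (i < k)%N by rewrite ltn_neqAle eq_sym ki.
      by have := ltn_ord k; lia.
    by have [r ->] := dvdlt _ _ _ gmin lt_kj; exists (f`_k * r); rewrite mulrCA.
  by exists (h`_(i + j) - r); rewrite mulrBr -eqs sE addrK.
case=> r E; have := A_fact.2 p pirr (f`_i) (g`_j) r; rewrite E mulrC => /(_ erefl).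
case=> -[t tE]; [apply: fi|apply: gj]; by exists t; rewrite tE mulrC.
Qed.

Lemma poly_irreducible_prim f p : irreducible_elt f -> (1 < size f)%N ->
  irreducible_elt p -> ~ exists f', f = p *: f'.
Proof.
move=> [f0 fU firr] sf [p0 pU _] [f' fE].
have := firr p%:P f'; rewrite mul_polyC => /(_ fE) [].
  by rewrite poly_unitE coefC /= => /andP[_]; rewrite (negPf pU).
rewrite poly_unitE => /andP[/eqP sf' _].
by move: sf; rewrite fE size_scale // sf'.
Qed.

(** The prime factors of [c] are cancelled one by one: each divides [h] or [f], and an irreducible
    [f] of positive degree has no constant prime factor. *)
Lemma irreducible_dvd_scale f g c : irreducible_elt f -> (1 < size f)%N ->
  c != 0 -> (exists h, c *: g = h * f) -> exists h, g = h * f.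
Proof.
move=> firr sf; move: c; apply: (factorial_ind A_fact) => [u uU|p a pirr a0 IH] [h hE].
  by exists (u^-1 *: h); rewrite -scalerAl -hE scalerA mulVr // scale1r.
have [p0 _ _] := pirr.
have [[h' h'E]|//] := gauss_prime pirr (etrans (esym hE) (esym (scalerA p a g))); last first.
  by move/(poly_irreducible_prim firr sf pirr).
apply: IH; exists h'; apply: (polyscaleI p0).
by rewrite scalerA hE h'E scalerAl.
Qed.

(** Denominator-free form of the irreducibility of [f] over the fraction field of [A]: each prime
    factor of [c] can be removed from [g] or from [h] without changing degrees. *)
Lemma irreducible_scale_split f c : irreducible_elt f -> (1 < size f)%N ->
  c != 0 -> forall g h, c *: f = g * h -> (size g <= 1)%N \/ (size h <= 1)%N.
Proof.
move=> firr sf; move: c; apply: (factorial_ind A_fact) => [u uU|p a pirr a0 IH] g h E.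
  have [_ _ /(_ (u^-1 *: g) h)] := firr.
  rewrite -scalerAl -E scalerA mulVr // scale1r => /(_ erefl)[] /[!poly_unitE].
    have u0 : u != 0 by apply: contraTneq uU => ->; rewrite unitr0.
    by rewrite size_scale ?invr_eq0 // => /andP[/eqP -> _]; left.
  by case/andP=> /eqP -> _; right.
have [p0 _ _] := pirr.
have [[g' g'E]|[h' h'E]] := gauss_prime pirr (etrans (esym E) (esym (scalerA p a f))).
  rewrite g'E size_scale //; apply: IH; apply: (polyscaleI p0).
  by rewrite scalerA E g'E scalerAl.
rewrite h'E size_scale //; apply: IH; apply: (polyscaleI p0).
by rewrite scalerA E h'E scalerAr.
Qed.

(** The gcd over the fraction field decides. If it is constant, clearing denominators in the Bezout
    relation yields [c]; otherwise it is proportional to [f], and divisibility by [f] descends to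
    [A]. *)
Lemma irreducible_dvd_or_Bezout f g : irreducible_elt f -> (1 < size f)%N ->
  (exists h, g = h * f) \/ (exists u v c, c != 0 /\ u * f + v * g = c%:P).
Proof.
move=> firr sf; have [f0 _ _] := firr.
have [sd|sd] := eqVneq (size (gcdp f g)) 1%N.
  right; have [[u v] /= /eqpP[[a b] /= /andP[a0 b0] E]] := Bezoutp f g.
  have /size_poly1P[c c0 dE] : size (gcdp f g) == 1%N by apply/eqP.
  exists (a *: u), (a *: v), (b * c); split; first by rewrite mulf_neq0.
  by rewrite -!scalerAl -scalerDr E dE -mul_polyC polyCM.
left; set d := gcdp f g in sd.
(* Over a domain, [gcdp] divides only up to nonzero scalars: [a *: f = q * d] and
   [b *: g = r * d]. *)
have [[a q] /= a0 fE] := Pdiv.Idomain.dvdpP _ _ (dvdp_gcdl f g).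
have [[b r] /= b0 gE] := Pdiv.Idomain.dvdpP _ _ (dvdp_gcdr f g).
have d0 : d != 0 by rewrite gcdp_eq0 negb_and f0.
have [sq|sd1] := irreducible_scale_split firr sf a0 fE; last first.
  by move: sd; rewrite eqn_leq sd1 /= lt0n size_poly_eq0 d0.
have [e qE] : exists e, q = e%:P by exists q`_0; apply: size1_polyC.
have e0 : e != 0.
  apply: contra_neq f0 => e0; apply: (polyscaleI a0).
  by rewrite fE qE e0 mul0r scaler0.
have [h dE] : exists h, d = h * f.
  apply: (irreducible_dvd_scale firr sf e0); exists a%:P.
  by rewrite mul_polyC fE qE mul_polyC.
apply: (irreducible_dvd_scale firr sf b0); exists (r * h).
by rewrite gE -/d dE mulrA.
Qed.

Lemma factorial_poly : factorial_domain {poly A}.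
Proof.
have [[N [NM N0]] Aprime] := A_fact; split.
  exists (fun f => (size f).-1 + N (lead_coef f))%N; split=> [f g fg0|f f0].
    have := fg0; rewrite mulf_eq0 negb_or => /andP[f0 g0].
    rewrite lead_coefM size_mul // addnACA.
    have -> : ((size f).-1 + (size g).-1 = (size f + size g).-2)%N.
      move: f0 g0; rewrite -!size_poly_gt0; lia.
    by rewrite leq_add2l NM // mulf_neq0 // lead_coef_eq0.
  move/eqP; rewrite addn_eq0 => /andP[/eqP sf /eqP Nf].
  have sf1 : size f = 1%N by move: f0 sf; rewrite -size_poly_gt0; case: (size f) => [|[]].
  rewrite poly_unitE sf1 eqxx /=; have := N0 _ _ Nf; rewrite lead_coef_eq0 f0 => /(_ isT).
  by rewrite /lead_coef sf1.
move=> f firr g h q ghE; have [f0 fU fs] := firr.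
have [sf|sf] := ltnP 1%N (size f).
  have [?|[u [v [c [c0 E]]]]] := irreducible_dvd_or_Bezout g firr sf; first by left.
  (* Multiplying the Bezout identity by [h] and using [g * h = q * f] gives
     [c *: h = (u * h + v * q) * f]. *)
  right; apply: (irreducible_dvd_scale firr sf c0); exists (u * h + v * q).
  by rewrite -mul_polyC -E !mulrDl mulrAC -!mulrA ghE.
(* A constant irreducible polynomial is an irreducible element of [A], hence prime by
   [gauss_prime]. *)
have fE := size1_polyC sf; set p := f`_0 in fE.
have pirr : irreducible_elt p.
  split; first by rewrite -polyC_eq0 -fE.
    apply: contra fU => pU; rewrite fE poly_unitE size_polyC coefC /= pU andbT.
    by have -> : p != 0 by apply: contraTneq pU => ->; rewrite unitr0.
  move=> a b pE; have := fs a%:P b%:P; rewrite fE pE polyCM => /(_ erefl).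
  by rewrite !poly_unitE !coefC /= => -[] /andP[]; [left|right].
have ghp : g * h = p *: q by rewrite ghE fE mulrC mul_polyC.
case: (gauss_prime pirr ghp) => -[r rE]; [left|right]; exists r; by rewrite rE fE mulrC mul_polyC.
Qed.
End Gauss.

Lemma unit_absz (a : int) : (a \is a GRing.unit) = (`|a|%N == 1%N).
Proof. by case: a => [[|[|n]]|[|n]]. Qed.

Lemma factorial_int : factorial_domain int.
Proof.
split.
  exists (fun a => trunc_log 2 `|a|); split=> [a b|a a0].
    rewrite mulf_eq0 negb_or -!absz_gt0 abszM => /andP[a0 b0].
    by rewrite trunc_log_max // ?expnD ?leq_mul ?trunc_logP.
  have := @trunc_log_ltn 2 `|a| isT => /[swap] ->.
  rewrite expn1 ltnS => a1.
  by rewrite unit_absz eqn_leq a1 absz_gt0.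
move=> p [p0 pU pirr] a b q abE.
have pprime : prime `|p|.
  apply/primeP; split.
    by rewrite ltn_neqAle absz_gt0 p0 andbT eq_sym; move: pU; rewrite unit_absz.
  move=> d /dvdnP[k pE].
  have [] := pirr (sgz p * k%:Z) d%:Z.
    by rewrite -mulrA -PoszM -pE -intEsg.
    rewrite unitrM => /andP[_]; rewrite unit_absz /= => /eqP k1.
    by apply/orP; right; rewrite pE k1 mul1n.
  by rewrite unit_absz /= => /eqP ->.
have: (`|p| %| `|a| * `|b|)%N by rewrite -abszM abE abszM dvdn_mull.
rewrite Euclid_dvdM // => /orP[] pd; [left|right];
  by have /dvdzP : (p %| _)%Z := pd.
Qed.

(** * Polynomials in n + 1 variables as univariate polynomials in the last variable *)

Section UniIso.
Variables (n : nat) (A : comNzRingType).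
Implicit Types (p : {mpoly A[n]}) (q : {mpoly A[n.+1]}) (f : {poly {mpoly A[n]}}).
Local Notation widen := (widen_ord (leqnSn _)).

Definition of_uni f : {mpoly A[n.+1]} := (map_poly (@mwiden n A) f).['X_ord_max].

Lemma of_uniD : {morph of_uni : f g / f + g}.
Proof. by move=> f g; rewrite /of_uni rmorphD hornerD. Qed.

Lemma muniX m : muni 'X_[A, m] =
  'X_[[multinom (m (widen i)) | i < n]] *: 'X^(m ord_max).
Proof. by rewrite muniE msuppX big_seq1 mcoeffX eqxx scale1r. Qed.

Lemma muni_mwiden p : muni (mwiden p) = p%:P.
Proof.
rewrite (mwidenE (leqnn (msize p))) [in RHS](mpolywE (leqnn (msize p))) !raddf_sum /=.
apply: eq_bigr => m _; rewrite muniZ muniX mnmwiden_ordmax expr0.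
rewrite -!mul_polyC -mul_mpolyC polyCM mulr1; congr (_ * ('X_[_])%:P).
by apply/mnmP => i; rewrite mnmE mnmwiden_widen.
Qed.

Lemma of_uniK : cancel of_uni (@muni n A).
Proof.
move=> f; rewrite /of_uni horner_coef raddf_sum /= size_map_inj_poly ?mwiden0 //; last first.
  exact: inj_mwiden.
rewrite -[RHS]coefK poly_def.
apply: eq_bigr => i _; rewrite muniM coef_map /= muni_mwiden mul_polyC; congr (_ *: _).
rewrite rmorphXn /= muniX mnm1E eqxx expr1.
set m := [multinom _ | j < n]; have -> : m = 0%MM.
  by apply/mnmP => j; rewrite mnmE mnm1E mnm0E -val_eqE /= gtn_eqF.
by rewrite mpolyX0 scale1r.
Qed.

Lemma muniK : cancel (@muni n A) of_uni.
Proof.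
move=> q; have of_uni0 : of_uni 0 = 0 by rewrite /of_uni map_poly0 horner0.
rewrite [in RHS](mpolyE q) muniE (big_morph _ of_uniD of_uni0).
apply: eq_bigr => m _; rewrite /of_uni -!mul_polyC !rmorphM /= !map_polyC map_polyXn /=.
rewrite !hornerM !hornerC hornerXn.
rewrite mwidenZ -scalerAl; congr (_ *: _).
rewrite mwidenX [RHS]mpolyXE_id big_ord_recr /= mpolyXE_id big_ord_recr /=.
rewrite mnmwiden_ordmax expr0 mulr1.
by congr (_ * _); apply: eq_bigr => i _; rewrite mnmwiden_widen mnmE.
Qed.

End UniIso.

(** * Transport of irreducibility and factoriality along a ring isomorphism *)

Section RingIso.
Variables (A B : idomainType) (phi : {rmorphism A -> B}) (psi : B -> A).
Hypotheses (phiK : cancel phi psi) (psiK : cancel psi phi).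

Lemma iso_unit a : (phi a \is a GRing.unit) = (a \is a GRing.unit).
Proof.
apply/idP/idP => [/unitrP[b [ba ab]]|]; last exact: rmorph_unit.
apply/unitrP; exists (psi b); split; apply: (can_inj phiK);
  by rewrite rmorphM psiK ?ba ?ab rmorph1.
Qed.

Lemma irreducible_iso p : irreducible_elt p -> irreducible_elt (phi p).
Proof.
move=> [p0 pU pirr]; split; last 1 first.
- move=> c d cd; rewrite -(psiK c) -(psiK d) !iso_unit; apply: pirr.
  by apply: (can_inj phiK); rewrite rmorphM !psiK.
- by rewrite -(rmorph0 phi) (inj_eq (can_inj phiK)).
by rewrite iso_unit.
Qed.

Lemma factorial_iso : factorial_domain B -> factorial_domain A.
Proof.
have phi_inj := can_inj phiK.
have phi0 a : (phi a == 0) = (a == 0) by rewrite -(inj_eq phi_inj) rmorph0.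
move=> [[N [NM N0]] Bprime]; split.
  exists (N \o phi); split=> [a b ab0|a a0 /= /N0].
    by rewrite /= rmorphM NM // -rmorphM phi0.
  by rewrite phi0 iso_unit; apply.
move=> p /irreducible_iso pirr a b q abE.
have := Bprime _ pirr (phi a) (phi b) (phi q); rewrite -!rmorphM abE => /(_ erefl) [].
  by case=> r rE; left; exists (psi r); apply: phi_inj; rewrite rmorphM psiK.
by case=> r rE; right; exists (psi r); apply: phi_inj; rewrite rmorphM psiK.
Qed.
End RingIso.

Lemma factorial_mpoly n : factorial_domain {mpoly int[n]}.
Proof.
elim: n => [|n IH].
  apply: (@factorial_iso _ _ (mcoeff 0%MM) (@mpolyC 0 int)) factorial_int.
    exact: mpolyKC.
  exact: mpolyCK.
apply: (@factorial_iso _ _ (@muni n int) (@of_uni n int)) (factorial_poly IH).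
  exact: muniK.
exact: of_uniK.
Qed.

(** * Divisibility from inclusion of complex zeros *)

Definition evalZ (B : comNzRingType) n (v : 'I_n -> B) : {mpoly int[n]} -> B :=
  meval v \o map_mpoly intr.
HB.instance Definition _ B n v := GRing.RMorphism.on (@evalZ B n v).

Lemma evalZX (B : comNzRingType) n (v : 'I_n -> B) i : evalZ v 'X_i = v i.
Proof. by rewrite /evalZ /= map_mpolyX mevalXU. Qed.

Section Zeros.
Variable K : numClosedFieldType.

Definition extend_point n (v : 'I_n -> K) (t : K) (i : 'I_n.+1) : K :=
  oapp v t (unlift ord_max i).

Lemma evalZ_extend n (v : 'I_n -> K) t (q : {mpoly int[n.+1]}) :
  evalZ (extend_point v t) q = (map_poly (evalZ v) (muni q)).[t].
Proof.
have vmax : extend_point v t ord_max = t by rewrite /extend_point unlift_none.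
have vwid i : extend_point v t (widen_ord (leqnSn _) i) = v i.
  have -> : widen_ord (leqnSn _) i = lift ord_max i.
    by apply: val_inj; rewrite /= /bump leqNgt ltn_ord.
  by rewrite /extend_point liftK.
rewrite muniE [in LHS](mpolyE q) rmorph_sum (rmorph_sum (map_poly (evalZ v))) horner_sum.
apply: eq_bigr => m _.
rewrite -!mul_polyC !rmorphM /= !map_polyC map_polyXn /= !hornerM !hornerC hornerXn.
rewrite /evalZ /= !map_mpolyZ !map_mpolyX !mevalZ !mevalX big_ord_recr /= vmax.
rewrite mulrA; congr (_ * _ * _).
by apply: eq_bigr => i _; rewrite vwid mnmE.
Qed.

(** By induction some [v] keeps the leading coefficient in the last variable nonzero; a value of
    that variable avoiding the roots then completes the point. *)
Lemma evalZ_nonvanishing n (q : {mpoly int[n]}) : q != 0 ->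
  exists v : 'I_n -> K, evalZ v q != 0.
Proof.
elim: n q => [|n IH] q q0.
  exists (fun _ => 0); rewrite -(mpolyKC q) /evalZ /= map_mpolyC mevalC intr_eq0.
  by apply: contra q0 => /eqP q00; rewrite -(mpolyKC q) q00 mpolyC0.
have u0 : muni q != 0.
  apply: contra_neq q0 => u0; apply: (can_inj (@muniK n int)).
  by rewrite u0 muni0.
have [v v0] := IH (lead_coef (muni q)) (etrans (congr1 negb (lead_coef_eq0 _)) u0).
have P0 : map_poly (evalZ v) (muni q) != 0.
  by apply: contraNneq v0 => P0; rewrite lead_coefE -coef_map P0 coef0.
have /closed_nonrootP[t tP] := P0.
by exists (extend_point v t); rewrite evalZ_extend.
Qed.

Lemma bezout_vanish (A B : pzRingType) (F : A -> B) (u d w e c : A) :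
  (forall p q, F (p + q) = F p + F q) -> (forall p q, F (p * q) = F p * F q) ->
  u * d + w * e = c -> F d = 0 -> F e = 0 -> F c = 0.
Proof. by move=> FD FM <- Fd Fe; rewrite FD !FM Fd Fe !mulr0 addr0. Qed.

(** The Nullstellensatz for an irreducible hypersurface, by elimination of the last variable; the
    size condition says that [D] involves this variable. *)
Lemma hypersurface_dvd n (D E : {mpoly int[n.+1]}) :
  irreducible_elt D -> (1 < size (muni D))%N ->
  (forall v : 'I_n.+1 -> K, evalZ v D = 0 -> evalZ v E = 0) ->
  exists h, E = h * D.
Proof.
move=> Dirr sD DE.
have uirr := irreducible_iso (@muniK n int) (@of_uniK n int) Dirr.
have [[h hE]|] := irreducible_dvd_or_Bezout (factorial_mpoly n) (muni E) uirr sD.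
  exists (of_uni h); apply: (can_inj (@muniK n int)).
  by rewrite rmorphM /= of_uniK.
case=> u [w [c [c0 uwc]]].
(* At [v] neither [c] nor the leading coefficient of [D] vanishes. The specialised [D] thus keeps
   its positive degree and has a root [t]; there [E] vanishes too, and the Bezout identity forces
   [c] to vanish at [v]. *)
have [v] : exists v : 'I_n -> K, evalZ v (c * lead_coef (muni D)) != 0.
  apply: evalZ_nonvanishing; rewrite mulf_neq0 // lead_coef_eq0.
  by rewrite -size_poly_gt0 ltnW.
rewrite rmorphM mulf_eq0 negb_or => /andP[vc vD].
have [t /rootP tD] : exists t, root (map_poly (evalZ v) (muni D)) t.
  by apply/closed_rootP; rewrite size_map_poly_id0 // gtn_eqF.
have tE := DE (extend_point v t); rewrite !evalZ_extend in tE.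
pose F p := (map_poly (evalZ v) p).[t].
have FM p q : F (p * q) = F p * F q by rewrite /F rmorphM hornerM.
have FD p q : F (p + q) = F p + F q by rewrite /F rmorphD hornerD.
have Fc : F c%:P = evalZ v c by rewrite /F map_polyC hornerC.
case/eqP: vc; apply: etrans (esym Fc) _.
exact: (bezout_vanish FD FM uwc tD (tE tD)).
Qed.
End Zeros.

(** * Koszul complexes of powers of the variables *)

Section MonomialQuotient.
Variables (n : nat) (A : comNzRingType).
Implicit Types (p q : {mpoly A[n]}) (k l m : 'X_{1..n}).

(** A linear left inverse of multiplication by ['X_[k]]. Applied to a syzygy, it shows that powers
    of distinct variables form a regular sequence. *)
Definition mquo k p : {mpoly A[n]} :=
  \sum_(m <- msupp p | (k <= m)%MM) p@_m *: 'X_[m - k].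

Lemma mcoeff_mquo k p m : (mquo k p)@_m = p@_(m + k).
Proof.
rewrite /mquo raddf_sum big_mkcond /=.
have E m' : (if (k <= m')%MM then (p@_m' *: 'X_[m' - k])@_m else 0) =
    (m' == (m + k)%MM)%:R * p@_m'.
  case: ifPn => km; last first.
    case: eqP => [m'E|_]; last by rewrite mul0r.
    by rewrite m'E lem_addl in km.
  rewrite mcoeffZ mcoeffX mulrC; congr (_%:R * _).
  by congr nat_of_bool; apply/eqP/eqP => [<-|->]; rewrite ?submK ?addmK.
rewrite (eq_bigr _ (fun m' _ => E m')).
have [mp|/memN_msupp_eq0 mp] := boolP ((m + k)%MM \in msupp p).
  rewrite (bigD1_seq (m + k)%MM) ?msupp_uniq //= eqxx mul1r big1 ?addr0 //.
  by move=> m' /negPf ->; rewrite mul0r.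
rewrite mp big1 // => m' _; case: eqP => [->|_]; first by rewrite mp mulr0.
by rewrite mul0r.
Qed.

Lemma mcoeffXM k p m :
  ('X_[k] * p)@_m = if (k <= m)%MM then p@_(m - k) else 0.
Proof.
case: ifPn => km; first by rewrite mulrC -{1}(submK km) addmC mcoeffMX.
apply/eqP; rewrite mulrC mcoeff_eq0 (perm_mem (msuppMX _ _)).
by apply/mapP => -[m' _ mE]; rewrite mE lem_addr in km.
Qed.

Lemma mquoD k p q : mquo k (p + q) = mquo k p + mquo k q.
Proof. by apply/mpolyP => m; rewrite mcoeffD !mcoeff_mquo mcoeffD. Qed.

Lemma mquoZ k (c : A) p : mquo k (c *: p) = c *: mquo k p.
Proof. by apply/mpolyP => m; rewrite mcoeffZ !mcoeff_mquo mcoeffZ. Qed.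

Lemma mquoXM k p : mquo k ('X_[k] * p) = p.
Proof. by apply/mpolyP => m; rewrite mcoeff_mquo mcoeffXM lem_addl addmK. Qed.

Lemma mquoXM_disjoint k l p : (forall i, k i = 0 \/ l i = 0)%N ->
  mquo k ('X_[l] * p) = 'X_[l] * mquo k p.
Proof.
move=> kl; apply/mpolyP => m; rewrite mcoeff_mquo !mcoeffXM.
have -> : (l <= m + k)%MM = (l <= m)%MM.
  apply/mnm_lepP/mnm_lepP => H i; have := H i; rewrite mnmDE;
  by case: (kl i) => ->; lia.
case: ifP => // /mnm_lepP lm; rewrite mcoeff_mquo; congr mcoeff.
by apply/mnmP => i; rewrite !(mnmDE, mnmBE); have := lm i; case: (kl i) => ->; lia.
Qed.

Lemma mquo_homog k p d : p \is d.-homog -> mquo k p \is (d - mdeg k).-homog.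
Proof.
move=> /dhomogP pd; apply/dhomogP => m; rewrite mcoeff_msupp mcoeff_mquo.
by rewrite -mcoeff_msupp => /pd <- ; rewrite /= mdegD addnK.
Qed.

End MonomialQuotient.

Lemma map_mquo n (A B : comNzRingType) (phi : {rmorphism A -> B}) k (p : {mpoly A[n]}) :
  map_mpoly phi (mquo k p) = mquo k (map_mpoly phi p).
Proof. by apply/mpolyP => m; rewrite mcoeff_map_mpoly !mcoeff_mquo mcoeff_map_mpoly. Qed.

(* The Koszul complex of (w0, w1, w2) is exact at its second spot modulo q *)
Definition koszul_exact (P : comNzRingType) (q w0 w1 w2 : P) : Prop :=
  forall d0 d1 d2 h, d0 * w0 + d1 * w1 + d2 * w2 = q * h ->
  exists e0 e1 e2 h0 h1 h2,
    [/\ d0 = w1 * e2 - w2 * e1 + q * h0,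
        d1 = w2 * e0 - w0 * e2 + q * h1 &
        d2 = w0 * e1 - w1 * e0 + q * h2].

(** The hypotheses say that [w0], [w1], [w2] is a regular sequence modulo [q]. They are used from
    the last to the first: [d2] is written in terms of [w0], [w1], [q] and substituted, then [d1] is
    treated in the same way, then [d0]. *)
Lemma regular_koszul_exact (P : comNzRingType) (q w0 w1 w2 : P) :
  (forall g k, w0 * g = q * k -> exists k', g = q * k') ->
  (forall g h k, w1 * g = w0 * h + q * k -> exists h' k', g = w0 * h' + q * k') ->
  (forall g h1 h2 k, w2 * g = w0 * h1 + w1 * h2 + q * k ->
     exists h1' h2' k', g = w0 * h1' + w1 * h2' + q * k') ->
  koszul_exact q w0 w1 w2.
Proof.
move=> P0 P1 P2 d0 d1 d2 h dE.
have [|k1 [k2 [k3 d2E]]] := P2 d2 (- d0) (- d1) h.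
  by rewrite -dE; ring.
have [|l [l' lE]] := P1 (d1 + k2 * w2) (- (d0 + k1 * w2)) (h - k3 * w2).
  rewrite mulrBr -dE d2E; ring.
have [|l'' l''E] := P0 (d0 + k1 * w2 + l * w1) (h - k3 * w2 - l' * w1).
  rewrite !mulrBr -dE d2E (_ : d1 = w0 * l + q * l' - k2 * w2); last by rewrite -lE addrK.
  by ring.
exists (- k2), k1, (- l), l'', l', k3; split.
- by rewrite -l''E; ring.
- by rewrite -(addrK (k2 * w2) d1) lE; ring.
by rewrite d2E; ring.
Qed.

Section Koszul3.
Variable A : comNzRingType.
Local Notation P := {mpoly A[3]}.

Lemma mquo_scal (k : 'X_{1..3}) (q : A) (p : P) : mquo k (q%:MP * p) = q%:MP * mquo k p.
Proof. by rewrite !mul_mpolyC mquoZ. Qed.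

(** Division by one power commutes with multiplication by constants and by powers of the other
    variables, so it carries each relation over to the quotient. Taking [q] to be 0 gives exactness
    over [A], taking it to be 6 gives exactness modulo 6. *)
Lemma monomial_koszul_exact (q : A) (i0 i1 i2 : 'I_3) (a0 a1 a2 : nat) :
  i0 != i1 -> i0 != i2 -> i1 != i2 ->
  koszul_exact q%:MP ('X_i0 ^+ a0 : P) ('X_i1 ^+ a1) ('X_i2 ^+ a2).
Proof.
move=> i01 i02 i12; rewrite !mpolyXn.
have dis i j a b : i != j -> forall k : 'I_3, ((U_(i) *+ a)%MM k = 0 \/ (U_(j) *+ b)%MM k = 0)%N.
  move=> ij k; rewrite !mulmnE !mnm1E; case: (eqVneq i k) => [<-|]; last by left; rewrite mul0n.
  by right; rewrite eq_sym (negPf ij) mul0n.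
apply: regular_koszul_exact => [g k|g h k|g h1 h2 k].
- move/(congr1 (mquo (U_(i0) *+ a0))); rewrite mquoXM mquo_scal => ->.
  by eexists.
- move/(congr1 (mquo (U_(i1) *+ a1))); rewrite mquoXM mquoD mquo_scal.
  by rewrite mquoXM_disjoint => [->|]; [eexists; eexists|apply: dis; rewrite eq_sym].
move/(congr1 (mquo (U_(i2) *+ a2))); rewrite mquoXM !mquoD mquo_scal.
rewrite !mquoXM_disjoint => [->||]; first by do 3!eexists.
  by apply: dis; rewrite eq_sym.
by apply: dis; rewrite eq_sym.
Qed.
End Koszul3.

(** * Determinants of 3 by 3 matrices whose product with a given vector is prescribed *)

Section Det3.
Variable P : comNzRingType.
Implicit Types (M : 'M[P]_3).

Lemma sum3 (V : nmodType) (F : 'I_3 -> V) : \sum_i F i = F 0 + F 1 + F 2%:R.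
Proof.
rewrite !big_ord_recl big_ord0 addr0 addrA; congr (F _ + F _ + F _);
  exact: val_inj.
Qed.

Lemma ord3P (T : 'I_3 -> Prop) : T 0 -> T 1 -> T 2%:R -> forall i, T i.
Proof.
move=> T0 T1 T2 [[|[|[|//]]] lti].
- by rewrite (_ : Ordinal lti = 0) //; apply: val_inj.
- by rewrite (_ : Ordinal lti = 1) //; apply: val_inj.
by rewrite (_ : Ordinal lti = 2%:R) //; apply: val_inj.
Qed.

Lemma det22 (N : 'M[P]_2) : \det N = N 0 0 * N 1 1 - N 0 1 * N 1 0.
Proof.
rewrite (expand_det_row _ 0) !big_ord_recl big_ord0 addr0 /cofactor !det_mx11 !mxE.
have -> : lift (0 : 'I_2) (0 : 'I_1) = 1 by apply: val_inj.
have -> : lift (1 : 'I_2) (0 : 'I_1) = 0 by apply: val_inj.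
by rewrite /= expr0 expr1 mul1r mulN1r mulrN.
Qed.

Lemma det33 M : \det M =
  M 0 0 * (M 1 1 * M 2%:R 2%:R - M 1 2%:R * M 2%:R 1)
  - M 0 1 * (M 1 0 * M 2%:R 2%:R - M 1 2%:R * M 2%:R 0)
  + M 0 2%:R * (M 1 0 * M 2%:R 1 - M 1 1 * M 2%:R 0).
Proof.
rewrite (expand_det_row _ 0) sum3 /cofactor !det22 !mxE.
have -> : lift (0 : 'I_3) (0 : 'I_2) = 1 by apply: val_inj.
have -> : lift (0 : 'I_3) (1 : 'I_2) = 2%:R by apply: val_inj.
have -> : lift (1 : 'I_3) (0 : 'I_2) = 0 by apply: val_inj.
have -> : lift (1 : 'I_3) (1 : 'I_2) = 2%:R by apply: val_inj.
have -> : lift (2%:R : 'I_3) (0 : 'I_2) = 0 by apply: val_inj.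
have -> : lift (2%:R : 'I_3) (1 : 'I_2) = 1 by apply: val_inj.
rewrite /= expr0 expr1 (_ : (-1) ^+ (0 + 2) = 1 :> P) ?sqrrN ?expr1n //.
by ring.
Qed.

Variables (w0 w1 w2 : P).

(** By exactness, each row of [M] differs from that of [M'] by a cross product of [w] with some
    vector. *)
Lemma det33_congr M M' (f : 'I_3 -> P) :
  koszul_exact 0 w0 w1 w2 ->
  (forall i, M i 0 * w0 + M i 1 * w1 + M i 2%:R * w2 = f i) ->
  (forall i, M' i 0 * w0 + M' i 1 * w1 + M' i 2%:R * w2 = f i) ->
  exists a : 'I_3 -> P, \det M = \det M' + \sum_i a i * f i.
Proof.
move=> Kw Mf M'f.
have K i : exists e : P * P * P, [/\
    M i 0 = M' i 0 + (w1 * e.2 - w2 * e.1.2),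
    M i 1 = M' i 1 + (w2 * e.1.1 - w0 * e.2) &
    M i 2%:R = M' i 2%:R + (w0 * e.1.2 - w1 * e.1.1)].
  have [|e0 [e1 [e2 [h0 [h1 [h2 [E0 E1 E2]]]]]]] :=
    Kw (M i 0 - M' i 0) (M i 1 - M' i 1) (M i 2%:R - M' i 2%:R) 0.
    by rewrite mul0r -(subrr (f i)) -{1}(Mf i) -(M'f i); ring.
  by exists (e0, e1, e2) => /=; rewrite -[M i 0](subrK (M' i 0)) -[M i 1](subrK (M' i 1))
    -[M i 2%:R](subrK (M' i 2%:R)) E0 E1 E2; split; ring.
have [[[x0 x1] x2] /= [X0 X1 X2]] := K 0.
have [[[y0 y1] y2] /= [Y0 Y1 Y2]] := K 1.
have [[[z0 z1] z2] /= [Z0 Z1 Z2]] := K 2%:R.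
pose dotx i := x0 * M i 0 + x1 * M i 1 + x2 * M i 2%:R.
pose doty i := y0 * M i 0 + y1 * M i 1 + y2 * M i 2%:R.
pose doty' i := y0 * M' i 0 + y1 * M' i 1 + y2 * M' i 2%:R.
pose dotz' i := z0 * M' i 0 + z1 * M' i 1 + z2 * M' i 2%:R.
(* The rows are exchanged one at a time, from the first to the last. Each exchange contributes a
   triple product (w x e) . (u x v) = (w . u)(e . v) - (w . v)(e . u), where u and v are the other
   two rows, up to order, and w . u, w . v are values of [f]. *)
exists (fun i => if i == 0 then - doty 2%:R + dotz' 1 else
  if i == 1 then dotx 2%:R - dotz' 0 else - dotx 1 + doty' 0).
rewrite sum3 /= -!M'f !det33 /dotx /doty /doty' /dotz' X0 X1 X2 Y0 Y1 Y2 Z0 Z1 Z2.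
by ring.
Qed.

(* Modulo q: x M = w cross e for some e, so x . (M e) = 0 and M e = x cross a for some a, whence
   x0 (det M) = (f cross M e)_0 = x0 (f . a). *)
Lemma det33_mod M (x0 x1 x2 q F : P) (f : 'I_3 -> P) :
  koszul_exact q w0 w1 w2 -> koszul_exact q x0 x1 x2 ->
  (forall g k, x0 * g = q * k -> exists k', g = q * k') ->
  (forall i, M i 0 * w0 + M i 1 * w1 + M i 2%:R * w2 = f i) ->
  x0 * f 0 + x1 * f 1 + x2 * f 2%:R = q * F ->
  exists (a : 'I_3 -> P) k, \det M = \sum_i a i * f i + q * k.
Proof.
move=> Kw Kx Rx Mf xf.
pose xM j := x0 * M 0 j + x1 * M 1 j + x2 * M 2%:R j.
have [|e0 [e1 [e2 [h0 [h1 [h2 [H0 H1 H2]]]]]]] := Kw (xM 0) (xM 1) (xM 2%:R) F.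
  by rewrite -xf -!Mf /xM; ring.
pose Me i := M i 0 * e0 + M i 1 * e1 + M i 2%:R * e2.
have [|a0 [a1 [a2 [k0 [k1 [k2 [K0 K1 K2]]]]]]] :=
    Kx (Me 0) (Me 1) (Me 2%:R) (h0 * e0 + h1 * e1 + h2 * e2).
  transitivity (xM 0 * e0 + xM 1 * e1 + xM 2%:R * e2); first by rewrite /Me /xM; ring.
  by rewrite H0 H1 H2; ring.
pose C0 := M 1 1 * M 2%:R 2%:R - M 1 2%:R * M 2%:R 1.
pose C1 := M 1 2%:R * M 2%:R 0 - M 1 0 * M 2%:R 2%:R.
pose C2 := M 1 0 * M 2%:R 1 - M 1 1 * M 2%:R 0.
pose af := a0 * f 0 + a1 * f 1 + a2 * f 2%:R.
have [|k kE] := Rx (\det M - af)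
    (h0 * C0 + h1 * C1 + h2 * C2 + f 1 * k2 - f 2%:R * k1 - a0 * F).
  (* [C0], [C1], [C2] are the cofactors of the first row, orthogonal to the two other rows; only the
     multiple [x0] of the first row contributes. *)
  have E : x0 * \det M = xM 0 * C0 + xM 1 * C1 + xM 2%:R * C2.
    by rewrite det33 /xM /C0 /C1 /C2; ring.
  have E' : (w1 * e2 - w2 * e1) * C0 + (w2 * e0 - w0 * e2) * C1 + (w0 * e1 - w1 * e0) * C2
      = f 1 * Me 2%:R - f 2%:R * Me 1.
    by rewrite -!Mf /Me /C0 /C1 /C2; ring.
  rewrite mulrBr E H0 H1 H2.
  transitivity ((f 1 * Me 2%:R - f 2%:R * Me 1) + q * (h0 * C0 + h1 * C1 + h2 * C2) - x0 * af).
    by rewrite -E'; ring.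
  rewrite K1 K2 !mulrBr [q * (a0 * F)]mulrCA -xf /af; ring.
exists (fun i => if i == 0 then a0 else if i == 1 then a1 else a2), k.
by rewrite sum3 /= -kE /af; ring.
Qed.
End Det3.

(** * Column operations on the Sylvester matrix *)

Lemma nth_allpairs (S T U : Type) (F : S -> T -> U) s t u0 s0 t0 j :
  (j < size s * size t)%N ->
  nth u0 [seq F x y | x <- s, y <- t] j = F (nth s0 s (j %/ size t)) (nth t0 t (j %% size t)).
Proof.
elim: s j => [|x s IH] j //=; rewrite mulSn => jlt.
rewrite nth_cat size_map; case: ltnP => jt.
  by rewrite divn_small // modn_small // (nth_map t0).
have t_gt0 : (0 < size t)%N by case: (size t) jlt jt => //; lia.
have -> : j = (size t + (j - size t))%N by lia.
rewrite divnDl ?dvdnn // divnn t_gt0 add1n modnDl /= addKn IH //; lia.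
Qed.

Lemma sum_divn_modn (V : nmodType) (a b : nat) (F : nat -> nat -> V) : (0 < b)%N ->
  \sum_(k < a * b) F (k %/ b)%N (k %% b)%N = \sum_(i < a) \sum_(l < b) F i l.
Proof.
move=> b0; elim: a => [|a IH]; first by rewrite !big_ord0.
rewrite big_ord_recr /= -IH mulSnr big_split_ord /=; congr (_ + _).
apply: eq_bigr => l _; rewrite divnMDl // divn_small ?addn0 //.
by rewrite modnMDl modn_small.
Qed.

Section Columns.
Variable A : comNzRingType.
Local Notation P := {mpoly A[3]}.
Implicit Types (f : P) (M : 'X_{1..3} -> 'M[P]_3) (G : 'I_45 -> P).
Local Notation mon8 i := (nth 0%MM (monoms 8) i).

Definition coefmx G : 'M[A]_45 := \matrix_(i, j) (G j)@_(mon8 i).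

Definition sylcol f M (j : 'I_45) : P :=
  if (j < 30)%N then 'X_[nth 0%MM (monoms 3) (j %% 10)] * f^`M(inord (j %/ 10))
  else \det (M (nth 0%MM (monoms 4) (j - 30))).

Lemma sylvester_coefmx f M : sylvester_matrix f M = coefmx (sylcol f M).
Proof.
apply/matrixP => i j; rewrite !mxE; congr mcoeff.
rewrite /sylvester_basis /sylcol nth_cat size_allpairs size_enum_ord size_monoms3.
case: ltnP => j30.
  rewrite (nth_allpairs _ _ ord0 0%MM) ?size_enum_ord ?size_monoms3 // /sylvester_map /=.
  have -> : nth ord0 (enum 'I_3) (j %/ 10) = inord (j %/ 10).
    by apply: val_inj; rewrite /= nth_enum_ord ?inordK //; lia.
  rewrite [X in _ + X]big1 ?addr0 => [|m _]; last by rewrite mcoeff0 scale0r.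
  rewrite (bigD1 (inord (j %/ 10))) //= big1 ?addr0 => [|k /negPf ki].
    by rewrite !mxE !eqxx mulr1.
  by rewrite !mxE /= ki mulr0 mul0r.
have j15 : (j - 30 < size (monoms 4))%N by rewrite size_monoms4; have := ltn_ord j; lia.
rewrite (nth_map 0%MM) // /sylvester_map /= big1 ?add0r => [|k _]; last by rewrite mxE mul0r.
rewrite (bigD1_seq _ (mem_nth 0%MM j15) (uniq_monoms 4)) /= mcoeffX eqxx scale1r.
by rewrite big1 ?addr0 // => m /negPf mk; rewrite mcoeffX eq_sym mk scale0r.
Qed.

Lemma det_unitrig (n : nat) (U : 'M[A]_n) :
  (forall k j : 'I_n, (k <= j)%N -> U k j = 0) -> \det (1%:M + U) = 1.
Proof.
move=> U0; rewrite det_trig; last first.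
  apply/is_trig_mxP => k j kj; rewrite !mxE U0 ?(ltnW kj) // addr0.
  by rewrite -val_eqE ltn_eqF.
by rewrite big1 // => k _; rewrite !mxE eqxx U0 // addr0.
Qed.

(** The operation is right multiplication by the unipotent matrix [1%:M + U]. Only coefficients at
    monomials of degree 8 are compared. *)
Lemma coefmx_column_op G G' (U : 'M[A]_45) :
  (forall k j : 'I_45, (k <= j)%N -> U k j = 0) \/
  (forall k j : 'I_45, (j <= k)%N -> U k j = 0) ->
  (forall i j : 'I_45, (G' j)@_(mon8 i) = (G j)@_(mon8 i) + \sum_k U k j * (G k)@_(mon8 i)) ->
  \det (coefmx G') = \det (coefmx G).
Proof.
move=> Utri GG'; have -> : coefmx G' = coefmx G *m (1%:M + U).
  apply/matrixP => i j; rewrite mulmxDr mulmx1 !mxE GG'; congr (_ + _).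
  by apply: eq_bigr => k _; rewrite mxE mulrC.
rewrite det_mulmx; case: Utri => U0; first by rewrite det_unitrig ?mulr1.
rewrite -(det_tr (1%:M + U)) linearD /= trmx1 det_unitrig ?mulr1 // => k j kj.
by rewrite mxE U0.
Qed.

Lemma det_coefmx_scale G (d : 'I_45 -> A) :
  \det (coefmx (fun j => d j *: G j)) = \prod_j d j * \det (coefmx G).
Proof.
have -> : coefmx (fun j => d j *: G j) = coefmx G *m diag_mx (\row_j d j).
  by apply/matrixP => i j; rewrite mul_mx_diag !mxE mcoeffZ mulrC.
rewrite det_mulmx det_diag mulrC; congr (_ * _).
by apply: eq_bigr => j _; rewrite mxE.
Qed.

(** Only the component of degree [d] of [a] reaches the coefficient at [n]. Multipliers obtained
    from Koszul exactness, which carry no degree information, can therefore be used in column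
    operations. *)
Lemma mcoeffM_homog (a g : P) d e (n : 'X_{1..3}) : g \is e.-homog -> mdeg n = (d + e)%N ->
  (a * g)@_n = \sum_(m <- monoms d) a@_m * ('X_[m] * g)@_n.
Proof.
move=> gh ndeg.
rewrite [a in LHS]mpolyE mulr_suml raddf_sum /= (bigID (fun m => mdeg m == d)) /=.
rewrite [X in _ + X]big1 ?addr0 => [|m md]; last first.
  rewrite -scalerAl mcoeffZ (@dhomog_nemf_coeff _ _ mdeg (mdeg m + e) ('X_[m] * g)) ?mulr0 //.
    by rewrite dhomogM // dhomogX /=.
  by rewrite /= ndeg eqn_add2r eq_sym.
rewrite [RHS](bigID (fun m => m \in msupp a)) /= [X in _ = _ + X]big1 ?addr0; last first.
  by move=> m /memN_msupp_eq0 ->; rewrite mul0r.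
rewrite -big_filter -[RHS]big_filter.
rewrite (perm_big [seq m <- monoms d | m \in msupp a]).
  by apply: eq_bigr => m _; rewrite -scalerAl mcoeffZ.
apply: uniq_perm => [||m]; [exact/filter_uniq/msupp_uniq|exact/filter_uniq/uniq_monoms|].
by rewrite !mem_filter mem_monoms andbC.
Qed.

Definition grad_factor f (m : 'X_{1..3}) (N : 'M[P]_3) : Prop :=
  forall i, N i 0 * 'X_0 ^+ (m 0).+1 + N i 1 * 'X_1 ^+ (m 1).+1 + N i 2%:R * 'X_2%:R ^+ (m 2%:R).+1
    = f^`M(i).

Lemma admissible_grad_factor f m N : admissible f m N -> grad_factor f m N.
Proof.
move=> [_ /matrixP E] i; have := E i 0; rewrite !mxE sum3 !mxE => ->.
by [].
Qed.

Lemma mcoeff_grad_comb f M (a : 'I_3 -> P) (n : 'X_{1..3}) :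
  (forall i, f^`M(i) \is 5.-homog) -> mdeg n = 8%N ->
  (\sum_i a i * f^`M(i))@_n =
  \sum_(k < 45 | (k < 30)%N) (a (inord (k %/ 10)))@_(nth 0%MM (monoms 3) (k %% 10))
     * (sylcol f M k)@_n.
Proof.
move=> fh ndeg; rewrite raddf_sum /=.
pose F i l := (a (inord i))@_(nth 0%MM (monoms 3) l) *
  ('X_[nth 0%MM (monoms 3) l] * f^`M(inord i))@_n.
transitivity (\sum_(i < 3) \sum_(l < 10) F i l).
  apply: eq_bigr => i _; rewrite (@mcoeffM_homog _ _ 3 5) //.
  by rewrite (big_nth 0%MM) size_monoms3 big_mkord /F inord_val.
rewrite -(sum_divn_modn 3 F) // /F.
rewrite (big_ord_widen 45 (fun k => F (k %/ 10)%N (k %% 10)%N)) // /F.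
by apply: eq_bigr => k k30; rewrite /sylcol k30.
Qed.

Lemma mdeg_mon8 (i : 'I_45) : mdeg (mon8 i) = 8%N.
Proof. by apply/eqP; rewrite -mem_monoms mem_nth // size_monoms8. Qed.

Lemma mdeg_mon4 (j : 'I_45) : (30 <= j)%N -> mdeg (nth 0%MM (monoms 4) (j - 30)) = 4%N.
Proof.
move=> j30; apply/eqP; rewrite -mem_monoms mem_nth // size_monoms4.
by have := ltn_ord j; lia.
Qed.

Lemma det_coefmx_mod_grad f M G :
  (forall i, f^`M(i) \is 5.-homog) ->
  (forall j : 'I_45, (j < 30)%N -> G j = sylcol f M j) ->
  (forall j : 'I_45, (30 <= j)%N -> exists a, sylcol f M j = G j + \sum_i a i * f^`M(i)) ->
  \det (sylvester_matrix f M) = \det (coefmx G).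
Proof.
move=> fh Glo Ghi; rewrite sylvester_coefmx.
have /choice[a aE] : forall j : 'I_45, exists a : 'I_3 -> P, (30 <= j)%N ->
    sylcol f M j = G j + \sum_i a i * f^`M(i).
  move=> j; have [j30|/Ghi[a aE]] := ltnP j 30; last by exists a.
  by exists (fun _ => 0) => ?; lia.
(* The operation adds to each of the last 15 columns a combination of the first 30, so its matrix is
   strictly upper triangular. *)
apply: (@coefmx_column_op G (sylcol f M)
  (\matrix_(k, j) if (30 <= j)%N && (k < 30)%N then
     (a j (inord (k %/ 10)))@_(nth 0%MM (monoms 3) (k %% 10)) else 0)).
  by right=> k j jk; rewrite mxE; case: ifP => // /andP[]; lia.
move=> i j; have [j30|j30] := ltnP j 30.
  rewrite Glo // big1 ?addr0 // => k _; rewrite mxE leqNgt j30 mul0r //.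
rewrite [in LHS]aE // mcoeffD (mcoeff_grad_comb M) //; last exact: mdeg_mon8.
congr (_ + _).
rewrite big_mkcond; apply: eq_bigr => k _; rewrite mxE j30 /=.
by case: ifP => [k30|]; rewrite ?mul0r ?Glo.
Qed.

Lemma det_sylvester_indep f M M' :
  (forall i, f^`M(i) \is 5.-homog) ->
  (forall m, mdeg m = 4%N -> grad_factor f m (M m)) ->
  (forall m, mdeg m = 4%N -> grad_factor f m (M' m)) ->
  \det (sylvester_matrix f M) = \det (sylvester_matrix f M').
Proof.
move=> fh Mf M'f; rewrite [in RHS]sylvester_coefmx; apply: det_coefmx_mod_grad => // j.
  by rewrite /sylcol => ->.
move=> j30; rewrite /sylcol ltnNge j30 /=; set m := nth _ _ _.
have m4 : mdeg m = 4%N := mdeg_mon4 j30.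
have Kw : koszul_exact 0 ('X_0 ^+ (m 0).+1 : P) ('X_1 ^+ (m 1).+1) ('X_2%:R ^+ (m 2%:R).+1).
  by rewrite -(mpolyC0 3); apply: monomial_koszul_exact.
exact: det33_congr Kw (Mf m m4) (M'f m m4).
Qed.

Lemma det_sylvester_content f M :
  (forall i, f^`M(i) \is 5.-homog) ->
  (forall m, mdeg m = 4%N -> grad_factor f m (M m)) ->
  'X_0 * f^`M(0) + 'X_1 * f^`M(1) + 'X_2%:R * f^`M(2%:R) = 6%:R *: f ->
  exists E, \det (sylvester_matrix f M) = 6%:R ^+ 21 * E.
Proof.
move=> fh Mf Ef.
(* The Euler identity is the relation required by [det33_mod], with [q] equal to 6 and the variables
   as [x0], [x1], [x2]. *)
have /choice[L LE] : forall j : 'I_45, exists l : P, (30 <= j)%N ->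
    exists a, sylcol f M j = 6%:R *: l + \sum_i a i * f^`M(i).
  move=> j; have [j30|j30] := ltnP j 30; first by exists 0 => ?; lia.
  rewrite /sylcol ltnNge j30 /=; set m := nth _ _ _.
  have m4 : mdeg m = 4%N := mdeg_mon4 j30.
  have Kw : koszul_exact (6%:R)%:MP
      ('X_0 ^+ (m 0).+1 : P) ('X_1 ^+ (m 1).+1) ('X_2%:R ^+ (m 2%:R).+1).
    exact: monomial_koszul_exact.
  have Kx : koszul_exact (6%:R)%:MP ('X_0 : P) 'X_1 'X_2%:R.
    exact: (@monomial_koszul_exact A 6%:R 0 1 2%:R 1 1 1).
  have Rx (g k : P) : 'X_0 * g = (6%:R)%:MP * k -> exists k', g = (6%:R)%:MP * k'.
    by move=> /(congr1 (mquo U_(0))); rewrite mquoXM mquo_scal => ->; eexists.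
  have [|a [k ->]] := det33_mod (F := f) Kw Kx Rx (Mf m m4); first by rewrite Ef mul_mpolyC.
  by exists k => _; exists a; rewrite addrC mul_mpolyC.
pose G1 (j : 'I_45) := if (j < 30)%N then sylcol f M j else 6%:R *: L j.
rewrite (@det_coefmx_mod_grad f M G1) //; last 2 first.
- by move=> j; rewrite /G1 => ->.
- by move=> j j30; rewrite /G1 ltnNge j30 /=; apply: LE.
(* In the order of [monoms 3], the cubics at positions 4 to 9 are those divisible by x. Such a
   column is x f_x times the quadratic monomial [mon j]. *)
pose euler (j : 'I_45) := (4 <= j < 10)%N.
pose mon (j : 'I_45) := (nth 0%MM (monoms 3) j - U_(0%R))%MM.
have monE (j : 'I_45) : euler j -> (nth 0%MM (monoms 3) j = mon j + U_(0%R))%MM.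
  rewrite /mon => ej; rewrite submK //; apply/mnm_lepP => i; rewrite mnm1E.
  by case: (eqVneq 0 i) => // <-; move: ej; rewrite /euler;
    case: j => [[|[|[|[|[|[|[|[|[|[|j]]]]]]]]]] ?].
have mon2 (j : 'I_45) : euler j -> mdeg (mon j) = 2%N.
  move=> ej; apply/eqP; rewrite -(eqn_add2r (mdeg (U_(0%R) : 'X_{1..3}))) -mdegD -monE // mdeg1.
  by rewrite -mem_monoms mem_nth // size_monoms3; case/andP: ej.
(* The position of the column [mon j] times x_i f_{x_i}. For [i] equal to 1 or 2 it is at least 10,
   hence beyond [j], and adding these columns is a strictly lower triangular operation. *)
pose idx i (j : 'I_45) : 'I_45 := inord (i * 10 + index (mon j + U_(inord i))%MM (monoms 3)).
have idxlt i (j : 'I_45) : euler j -> (index (mon j + U_(inord i))%MM (monoms 3) < 10)%N.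
  by move=> ej; rewrite -size_monoms3 index_mem mem_monoms mdegD mon2 // mdeg1.
have idxE i (j : 'I_45) : euler j -> (i < 3)%N ->
    idx i j = (i * 10 + index (mon j + U_(inord i))%MM (monoms 3))%N :> nat.
  by move=> ej i3; rewrite inordK //; have := idxlt i j ej; lia.
have idxG i (j : 'I_45) : euler j -> (i < 3)%N ->
    G1 (idx i j) = 'X_[mon j] * ('X_(inord i) * f^`M(inord i)).
  move=> ej i3; have il := idxlt i j ej; rewrite /G1 /sylcol idxE //.
  have -> : (i * 10 + index (mon j + U_(inord i))%MM (monoms 3) < 30)%N by lia.
  rewrite divnMDl // (divn_small il) addn0 modnMDl (modn_small il).
  have im : (mon j + U_(inord i))%MM \in monoms 3 by rewrite -index_mem size_monoms3.
  by rewrite (nth_index 0%MM im) mpolyXD -mulrA.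
clearbody idx; pose G2 (j : 'I_45) := if euler j then 6%:R *: ('X_[mon j] * f) else G1 j.
rewrite -(@coefmx_column_op G1 G2 (\matrix_(k, j)
   if euler j then (k == idx 1 j)%:R + (k == idx 2 j)%:R else 0)); last 2 first.
- left=> k j kj; rewrite mxE; case: ifP => // ej; move/andP: (ej) => [_ j10].
  have Nk i : (0 < i < 3)%N -> (k == idx i j) = false.
    move=> /andP[i0 i3]; apply/negbTE/eqP => kE.
    by have := idxE i j ej i3; rewrite -kE; lia.
  by rewrite (Nk 1%N isT) (Nk 2%N isT) addr0.
- move=> i j; rewrite {1}/G2; case: ifP => ej; last first.
    by rewrite big1 ?addr0 // => k _; rewrite mxE ej mul0r.
  rewrite (eq_bigr (fun k => (k == idx 1 j)%:R * (G1 k)@_(mon8 i)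
    + (k == idx 2 j)%:R * (G1 k)@_(mon8 i))); last first.
    by move=> k _; rewrite mxE ej mulrDl.
  have sum1 l : \sum_k (k == idx l j)%:R * (G1 k)@_(mon8 i) = (G1 (idx l j))@_(mon8 i).
    rewrite (bigD1 (idx l j)) //= eqxx mul1r big1 ?addr0 // => k /negPf ->.
    by rewrite mul0r.
  have GjE : G1 j = 'X_[mon j] * ('X_0 * f^`M(0)).
    rewrite /G1 /sylcol; move/andP: (ej) => [_ j10].
    have -> : (j < 30)%N by lia.
    rewrite modn_small // divn_small // monE // mpolyXD mulrA.
    by congr (_ * _^`M(_)); apply: val_inj; rewrite /= inordK.
  rewrite big_split /= !sum1 GjE !idxG // addrA -!mcoeffD; congr mcoeff.
  have -> : inord 1 = 1 :> 'I_3 by apply: val_inj; rewrite /= inordK.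
  have -> : inord 2 = 2%:R :> 'I_3 by apply: val_inj; rewrite /= inordK.
  by rewrite -!mulrDr Ef scalerAr.
(* The columns divisible by 6: six from the Euler identity and the last fifteen, 21 in all. *)
pose d (j : 'I_45) := (euler j || (30 <= j))%N.
pose H (j : 'I_45) := if euler j then 'X_[mon j] * f else if (j < 30)%N then sylcol f M j else L j.
have GH j : G2 j = (6%:R ^+ d j : A) *: H j.
  rewrite /G2 /d /H /G1; case: ifP => ej; rewrite ?expr1 //=.
  by case: ltnP => j30; rewrite ?expr1 // expr0 scale1r.
exists (\det (coefmx H)).
rewrite (_ : coefmx G2 = coefmx (fun j => (6%:R ^+ d j : A) *: H j)); last first.
  by apply/matrixP => i j; rewrite !mxE GH.
rewrite det_coefmx_scale; congr (_ * _).
rewrite prodrXr; congr (_ ^+ _).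
by rewrite /d /euler !big_ord_recl big_ord0.
Qed.

End Columns.

(** * The determinant as a function of the sextic *)

Section Homogeneous.
Variable A : comNzRingType.

Lemma mderiv_homog n (p : {mpoly A[n]}) d i : p \is d.-homog -> p^`M(i) \is (d.-1).-homog.
Proof.
move=> /dhomogP pd; apply/dhomogP => m; rewrite mcoeff_msupp mcoeff_deriv => pm.
have /pd /= <- : (m + U_(i))%MM \in msupp p.
  by rewrite mcoeff_msupp; apply: contraNneq pm => ->; rewrite mul0rn.
by rewrite mdegD mdeg1 addn1.
Qed.

Lemma euler_identity n (p : {mpoly A[n]}) d : p \is d.-homog ->
  \sum_i 'X_i * p^`M(i) = d%:R *: p.
Proof.
move=> pd; apply/mpolyP => m; rewrite raddf_sum mcoeffZ /=.
transitivity (\sum_(i < n) p@_m *+ m i).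
  apply: eq_bigr => i _; rewrite mcoeffXM mcoeff_deriv.
  case: ifPn => [im|]; last first.
    by rewrite lep1mP negbK => /eqP ->; rewrite mulr0n.
  rewrite submK // mnmBE mnm1E eqxx subn1 prednK // lt0n.
  by rewrite -lep1mP.
rewrite sumrMnr -mdegE mulr_natl; have [<-//|md] := eqVneq (mdeg m) d.
by rewrite (@dhomog_nemf_coeff _ _ mdeg d p) // !mul0rn.
Qed.

Lemma homog_monoms (p : {mpoly A[3]}) d : p \is d.-homog ->
  p = \sum_(m <- monoms d) p@_m *: 'X_[m].
Proof.
move=> pd; apply/mpolyP => n; rewrite raddf_sum /=.
have [nd|nd] := boolP (n \in monoms d).
  rewrite (bigD1_seq n) ?uniq_monoms //= mcoeffZ mcoeffX eqxx mulr1 big1 ?addr0 // => m /negPf mn.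
  by rewrite mcoeffZ mcoeffX mn mulr0.
rewrite big1_seq => [|m /andP[_ md]].
  by rewrite (@dhomog_nemf_coeff _ _ mdeg d p) // -mem_monoms.
rewrite mcoeffZ mcoeffX; case: eqP => [mn|_]; last by rewrite mulr0.
by rewrite -mn md in nd.
Qed.

Lemma sextic_homog (c : 'I_28 -> A) : sextic c \is 6.-homog.
Proof.
rewrite /sextic; apply: rpred_sum => k _; apply: dhomogZ.
by rewrite dhomogX /= -mem_monoms mem_nth // size_monoms6.
Qed.

Lemma sextic_deriv_homog (c : 'I_28 -> A) i : (sextic c)^`M(i) \is 5.-homog.
Proof. exact: mderiv_homog (sextic_homog c). Qed.

End Homogeneous.

Section Canonical.
Variable A : comNzRingType.
Local Notation P := {mpoly A[3]}.

Definition mrem n (k : 'X_{1..n}) (p : {mpoly A[n]}) := p - 'X_[k] * mquo k p.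

Lemma mcoeff_mrem n (k : 'X_{1..n}) p m : (mrem k p)@_m = if (k <= m)%MM then 0 else p@_m.
Proof.
rewrite mcoeffB mcoeffXM; case: ifP => km; last by rewrite subr0.
by rewrite mcoeff_mquo submK // subrr.
Qed.

Lemma mrem_homog n (k : 'X_{1..n}) p d : p \is d.-homog -> mrem k p \is d.-homog.
Proof.
move=> /dhomogP pd; apply/dhomogP => m; rewrite mcoeff_msupp mcoeff_mrem.
by case: ifP => [_|_]; rewrite ?eqxx // -mcoeff_msupp => /pd.
Qed.

(* Successive division of the partial derivatives by x^(r+1), y^(s+1), z^(t+1) *)
Definition canonical_factor (f : P) (m : 'X_{1..3}) : 'M[P]_3 :=
  let w (j : 'I_3) := (U_(j) *+ (m j).+1)%MM in
  \matrix_(i, j) if j == 0 then mquo (w 0) f^`M(i)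
    else if j == 1 then mquo (w 1) (mrem (w 0) f^`M(i))
    else mquo (w 2%:R) (mrem (w 1) (mrem (w 0) f^`M(i))).

(** After the three divisions, a monomial left in the remainder has each exponent at most that of
    [m], hence degree at most 4, whereas the derivatives have degree 5. *)
Lemma canonical_grad_factor f m : (forall i, f^`M(i) \is 5.-homog) -> mdeg m = 4%N ->
  grad_factor f m (canonical_factor f m).
Proof.
move=> fh m4 i; rewrite !mxE /=.
set w := fun j : 'I_3 => (U_(j) *+ (m j).+1)%MM; set g := f^`M(i).
rewrite !mpolyXn -/(w 0) -/(w 1) -/(w 2%:R).
have remE k (p : P) : mquo k p * 'X_[k] = p - mrem k p by rewrite /mrem opprB addrC subrK mulrC.
rewrite !remE.
suff -> : mrem (w 2%:R) (mrem (w 1) (mrem (w 0) g)) = 0 by ring.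
apply/mpolyP => n; rewrite !mcoeff_mrem mcoeff0.
have wP j : (w j <= n)%MM = (m j < n j)%N.
  apply/mnm_lepP/idP => [/(_ j)|jn k]; rewrite mulmnE mnm1E ?eqxx ?mul1n //.
  by case: eqP => [<-|_]; rewrite ?mul1n ?mul0n.
rewrite !wP; do 3!case: ltnP => //.
move=> n0 n1 n2; apply: (@dhomog_nemf_coeff _ _ mdeg 5); first exact: fh.
by move: m4 => /=; rewrite !mdegE !sum3; lia.
Qed.

Lemma canonical_factor_homog f m i j : (forall i, f^`M(i) \is 5.-homog) ->
  canonical_factor f m i j \is (4 - m j).-homog.
Proof.
move=> fh; have wdeg (k : 'I_3) : (5 - mdeg (U_(k) *+ (m k).+1) = 4 - m k)%N.
  by rewrite mdegMn mdeg1 mul1n subSS.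
move: j; apply: ord3P; rewrite !mxE /= -wdeg;
  by do ![apply: mquo_homog | apply: mrem_homog]; apply: fh.
Qed.

(** The canonical factors are built by operations natural in the coefficient ring, so this is one
    function of the coefficients for all rings, compatible with morphisms. *)
Definition sextic_disc (c : 'I_28 -> A) : A :=
  \det (sylvester_matrix (sextic c) (canonical_factor (sextic c))).

Lemma sextic_discE c (M : 'X_{1..3} -> 'M[P]_3) :
  (forall m, mdeg m = 4%N -> grad_factor (sextic c) m (M m)) ->
  \det (sylvester_matrix (sextic c) M) = sextic_disc c.
Proof.
move=> Mf; apply: det_sylvester_indep => // [|m m4]; first exact: sextic_deriv_homog.
by apply: canonical_grad_factor => //; apply: sextic_deriv_homog.
Qed.

Lemma sextic_disc_content c : exists E, sextic_disc c = 6%:R ^+ 21 * E.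
Proof.
have fh := sextic_deriv_homog c.
apply: det_sylvester_content => // [m m4|]; first exact: canonical_grad_factor.
by have := euler_identity (sextic_homog c); rewrite sum3.
Qed.

End Canonical.

Section Functoriality.
Variables (A B : comNzRingType) (phi : {rmorphism A -> B}).
Local Notation Phi := (map_mpoly phi).

Lemma map_mderiv n (p : {mpoly A[n]}) i : (Phi p)^`M(i) = Phi p^`M(i).
Proof.
by apply/mpolyP => m; rewrite mcoeff_deriv !mcoeff_map_mpoly mcoeff_deriv raddfMn.
Qed.

Lemma map_mrem n (k : 'X_{1..n}) (p : {mpoly A[n]}) : Phi (mrem k p) = mrem k (Phi p).
Proof. by rewrite /mrem rmorphB rmorphM /= map_mpolyX map_mquo. Qed.

Lemma map_sextic (c : 'I_28 -> A) : Phi (sextic c) = sextic (phi \o c).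
Proof.
rewrite /sextic rmorph_sum; apply: eq_bigr => k _.
by rewrite /= map_mpolyZ map_mpolyX.
Qed.

Lemma map_canonical_factor (f : {mpoly A[3]}) m :
  canonical_factor (Phi f) m = map_mx Phi (canonical_factor f m).
Proof.
apply/matrixP => i j; rewrite !mxE !map_mderiv.
by case: ifP => _; [|case: ifP => _]; rewrite map_mquo ?map_mrem.
Qed.

Lemma map_sextic_disc c : phi (sextic_disc c) = sextic_disc (phi \o c).
Proof.
rewrite /sextic_disc -det_map_mx !sylvester_coefmx; congr (\det _).
apply/matrixP => i j; rewrite !mxE -mcoeff_map_mpoly; congr mcoeff.
rewrite /sylcol -map_sextic; case: ifP => _.
  by rewrite rmorphM /= map_mpolyX map_mderiv.
by rewrite map_canonical_factor det_map_mx.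
Qed.
End Functoriality.

Lemma eq_sextic_disc (A : comNzRingType) (c c' : 'I_28 -> A) :
  c =1 c' -> sextic_disc c = sextic_disc c'.
Proof. by move=> /funext ->. Qed.

(** * Degrees of the determinant and its vanishing at singular sextics *)

Section Graded.
Variables (P : comNzRingType) (Gr : nat -> {pred P}).
Hypotheses (Gr_sum : forall d (I : finType) (F : I -> P),
    (forall i, F i \in Gr d) -> \sum_i F i \in Gr d)
  (GrN : forall d a, a \in Gr d -> - a \in Gr d) (Gr1 : 1 \in Gr 0)
  (GrM : forall d e a b, a \in Gr d -> b \in Gr e -> a * b \in Gr (d + e)%N).

(** The grading is abstract because it serves twice: for the degree of a polynomial, and for the
    degree in the unknowns c_ijk of all coefficients of a form. *)
Lemma det_graded n (N : 'M[P]_n) (d : 'I_n -> nat) :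
  (forall i j, N i j \in Gr (d j)) -> \det N \in Gr (\sum_j d j)%N.
Proof.
move=> Nd; apply: Gr_sum => s; rewrite mulr_sign.
suff Gs : \prod_i N i (s i) \in Gr (\sum_j d j)%N by case: ifP => // _; apply: GrN.
(* Reindexing the degree sum along [s] matches the degrees with the factors of the product one by
   one. *)
rewrite [X in Gr X](reindex_inj (@perm_inj _ s)) /=.
apply: (big_ind2 (fun (a : P) (e : nat) => a \in Gr e)) => [//|a1 d1 a2 d2|i _].
  exact: GrM.
exact: Nd.
Qed.
End Graded.

Lemma det_homog (A : comNzRingType) k n (N : 'M[{mpoly A[k]}]_n) (d : 'I_n -> nat) :
  (forall i j, N i j \is (d j).-homog) -> \det N \is (\sum_j d j)%N.-homog.
Proof.
apply: (@det_graded _ (fun e => [pred p : {mpoly A[k]} | p \is e.-homog]))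
  => [e I F FE|e a||e e' a b].
- by rewrite inE; apply: rpred_sum => i _; apply: FE.
- by rewrite !inE; rewrite dhomogN.
- by rewrite inE dhomog1.
by rewrite !inE; apply: dhomogM.
Qed.

Lemma sylcol_homog (A : comNzRingType) (c : 'I_28 -> A) j :
  sylcol (sextic c) (canonical_factor (sextic c)) j \is 8.-homog.
Proof.
have fh := sextic_deriv_homog c; rewrite /sylcol; case: ltnP => j30.
  apply: (@dhomogM _ _ mdeg 3 _ 5); last exact: fh.
  by rewrite dhomogX /= -mem_monoms mem_nth // size_monoms3; lia.
set m := nth _ _ _; have m4 : mdeg m = 4%N := mdeg_mon4 j30.
(* The exponents of [m] sum to 4, so the column degrees sum to 12 - 4. *)
have -> : 8%N = (\sum_(i < 3) (4 - m i))%N.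
  by move: m4; rewrite mdegE !sum3; lia.
by apply: det_homog => i k; apply: canonical_factor_homog.
Qed.

(** The values at the singular point of the monomials of degree 8 form a left kernel vector: its
    product with the matrix lists the values of the columns there. *)
Lemma singular_sextic_disc (F : fieldType) (c : 'I_28 -> F) :
  singular_curve (sextic c) -> sextic_disc c = 0.
Proof.
move=> [p [[k pk] _ pf]]; have fh := sextic_deriv_homog c.
pose v : 'rV[F]_45 := \row_i ('X_[nth 0%MM (monoms 8) i] : {mpoly F[3]}).@[p].
apply/eqP/det0P; exists v.
  have k8 : (U_(k) *+ 8)%MM \in monoms 8 by rewrite mem_monoms mdegMn mdeg1.
  (* The entry of [v] at the eighth power of the k-th variable is the eighth power of [p k], which
     is nonzero. *)
  apply: contraNneq pk => v0.
  have i45 : (index (U_(k) *+ 8)%MM (monoms 8) < 45)%N by rewrite -size_monoms8 index_mem.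
  have := congr1 (fun u : 'rV[F]_45 => u 0 (Ordinal i45)) v0.
  have E : nth 0%MM (monoms 8) (Ordinal i45) = (U_(k) *+ 8)%MM := nth_index _ k8.
  rewrite !mxE E -mpolyXn rmorphXn /= mevalXU => /eqP.
  by rewrite expf_eq0.
rewrite sylvester_coefmx; apply/rowP => j; rewrite !mxE.
transitivity (sylcol (sextic c) (canonical_factor (sextic c)) j).@[p].
  rewrite [in RHS](homog_monoms (sylcol_homog c j)) (big_nth 0%MM) size_monoms8 big_mkord raddf_sum.
  by apply: eq_bigr => i _; rewrite !mxE /= mevalZ mulrC.
rewrite /sylcol; case: ltnP => j30; first by rewrite rmorphM /= pf mulr0.
set m := nth _ _ _; have m4 : mdeg m = 4%N := mdeg_mon4 j30.
have := canonical_grad_factor fh m4; move: (canonical_factor _ m) => N gN.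
(* At the singular point the factor matrix kills the nonzero vector of the powers of the
   coordinates, so its determinant vanishes there. *)
rewrite -det_map_mx -det_tr; apply/eqP/det0P.
exists (\row_l (p l) ^+ (m l).+1).
  by apply: contraNneq pk => /rowP/(_ k); rewrite !mxE => /eqP; rewrite expf_eq0.
have XE l e : ('X_l ^+ e : {mpoly F[3]}).@[p] = p l ^+ e by rewrite rmorphXn /= mevalXU.
have mulE a l e : p l ^+ e * a.@[p] = (a * 'X_l ^+ e).@[p] by rewrite mevalM XE mulrC.
apply/rowP => i; rewrite !mxE sum3 !mxE !mulE -!mevalD.
by rewrite (gN i) pf.
Qed.

Section DegreeInCoefficients.
Variables (A : comNzRingType) (n : nat).
Local Notation B := {mpoly A[n]}.
Local Notation P := {mpoly B[3]}.

Definition coef_homog (d : nat) (p : P) : Prop := forall m, p@_m \is d.-homog.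

Lemma coef_homogM d e (p q : P) : coef_homog d p -> coef_homog e q -> coef_homog (d + e) (p * q).
Proof.
move=> pd qe m; rewrite mcoeffM; apply: rpred_sum => k _.
exact: dhomogM.
Qed.

Lemma coef_homog_mquo d k (p : P) : coef_homog d p -> coef_homog d (mquo k p).
Proof. by move=> pd m; rewrite mcoeff_mquo. Qed.

Lemma coef_homog_mrem d k (p : P) : coef_homog d p -> coef_homog d (mrem k p).
Proof. by move=> pd m; rewrite mcoeff_mrem; case: ifP => _; rewrite ?dhomog0. Qed.

Lemma coef_homog_det k (N : 'M[P]_k) d :
  (forall i j, coef_homog d (N i j)) -> coef_homog (k * d) (\det N).
Proof.
move=> Nd; have -> : (k * d = \sum_(j < k) d)%N by rewrite sum_nat_const card_ord.
apply/asboolP; apply: (@det_graded _ (fun e => [pred p : P | `[< coef_homog e p >]]))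
  => [e I F FE|e a|||].
- rewrite inE; apply/asboolP => m; rewrite raddf_sum; apply: rpred_sum => i _.
  by have /asboolP := FE i; apply.
- by rewrite !inE => /asboolP ae; apply/asboolP => m; rewrite mcoeffN dhomogN.
- by rewrite inE; apply/asboolP => m; rewrite mcoeff1; case: eqP => _; rewrite ?dhomog1 ?dhomog0.
- by move=> e e' a b; rewrite !inE => /asboolP ae /asboolP be; apply/asboolP; apply: coef_homogM.
by move=> i j; rewrite inE; apply/asboolP.
Qed.
End DegreeInCoefficients.

Lemma sextic_disc_homog (A : comNzRingType) :
  sextic_disc (fun k : 'I_28 => 'X_k : {mpoly A[28]}) \is 75.-homog.
Proof.
set c := fun k : 'I_28 => _.
have fh i : coef_homog 1 (sextic c)^`M(i).
  move=> m; rewrite mcoeff_deriv; apply: rpredMn; rewrite raddf_sum /=; apply: rpred_sum => k _.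
  by rewrite mcoeffZ mcoeffX; case: eqP => _; rewrite ?mulr1 ?mulr0 ?dhomog0 // dhomogX /= mdeg1.
(* Thirty columns are linear in the unknown coefficients and fifteen are cubic. *)
have -> : 75%N = (\sum_(j < 45) if (j < 30)%N then 1 else 3)%N.
  by rewrite !big_ord_recl big_ord0.
rewrite /sextic_disc sylvester_coefmx; apply: det_homog => i j; rewrite mxE /sylcol.
case: ltnP => j30.
  by rewrite mcoeffXM; case: ifP => _; [exact: fh|exact: dhomog0].
apply: (@coef_homog_det _ _ 3 _ 1) => {}i k; rewrite mxE.
by do 2?case: ifP => _; do ![apply: coef_homog_mquo | apply: coef_homog_mrem].
Qed.

(** * Two explicit sextics *)

(* Ternary forms as lists of terms, on which the Sylvester matrix can be computed *)
Definition term : Type := (int * (nat * nat * nat))%type.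

Definition mon_of (t : nat * nat * nat) : 'X_{1..3} := mon3 t.1.1 t.1.2 t.2.

Definition expo (i : nat) (t : nat * nat * nat) : nat :=
  match i with 0 => t.1.1 | 1 => t.1.2 | _ => t.2 end.

Definition map_expo (g : nat -> nat -> nat) (t : nat * nat * nat) :=
  (g 0 t.1.1, g 1 t.1.2, g 2 t.2)%N.

Definition triples (d : nat) : seq (nat * nat * nat) :=
  [seq (r, s, d - r - s)%N | r <- iota 0 d.+1, s <- iota 0 (d - r).+1].

Definition tcoef (l : seq term) (t : nat * nat * nat) : int :=
  foldr (fun x s => (if x.2 == t then x.1 else 0) + s) 0 l.

Definition tmul (l l' : seq term) : seq term :=
  [seq (x.1 * y.1, (x.2.1.1 + y.2.1.1, x.2.1.2 + y.2.1.2, x.2.2 + y.2.2)%N) | x <- l, y <- l'].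

Definition topp (l : seq term) : seq term := [seq (- x.1, x.2) | x <- l].

Definition tderiv (i : nat) (l : seq term) : seq term :=
  [seq (x.1 *+ expo i x.2, map_expo (fun j e => (e - (i == j))%N) x.2)
  | x <- l & expo i x.2 != 0%N].

(* Each term of a partial derivative is charged to the first possible column. *)
Definition tfactor (l : seq term) (m : nat * nat * nat) (i j : nat) : seq term :=
  [seq (x.1, map_expo (fun k e => if k == j then (e - (expo j m).+1)%N else e) x.2)
  | x <- tderiv i l & find (fun k => expo k m < expo k x.2)%N (iota 0 3) == j].

Definition tdet (N : nat -> nat -> seq term) : seq term :=
  let minor a b c d := tmul (N a b) (N c d) ++ topp (tmul (N a d) (N c b)) in
  tmul (N 0 0) (minor 1 1 2 2) ++ topp (tmul (N 0 1) (minor 1 0 2 2))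
  ++ tmul (N 0 2) (minor 1 0 2 1).

Definition tsylcol (l : seq term) (j : nat) : seq term :=
  if (j < 30)%N then
    tmul [:: (1, nth (0, 0, 0)%N (triples 3) (j %% 10))] (tderiv (j %/ 10) l)
  else tdet (tfactor l (nth (0, 0, 0)%N (triples 4) (j - 30))).

Definition tsylvester (l : seq term) (i j : nat) : int :=
  tcoef (tsylcol l j) (nth (0, 0, 0)%N (triples 8) i).

Definition tfactor_ok (l : seq term) (m : nat * nat * nat) (i : nat) : bool :=
  let pw j := [:: (1 : int, map_expo (fun k _ => if k == j then (expo j m).+1 else 0%N) m)] in
  let l1 := tmul (tfactor l m i 0) (pw 0%N) ++ tmul (tfactor l m i 1) (pw 1%N)
    ++ tmul (tfactor l m i 2) (pw 2%N) in
  let l2 := tderiv i l in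
  all (fun x => tcoef l1 x.2 == tcoef l2 x.2) (l1 ++ l2).

Definition tform (l : seq term) : {mpoly int[3]} := \sum_(x <- l) x.1 *: 'X_[mon_of x.2].

Lemma monoms_triples d : monoms d = map mon_of (triples d).
Proof. by rewrite /monoms /triples map_allpairs. Qed.

Lemma nth_monoms d k : (k < size (monoms d))%N ->
  nth 0%MM (monoms d) k = mon_of (nth (0, 0, 0)%N (triples d) k).
Proof.
by move=> kd; rewrite monoms_triples (nth_map (0, 0, 0)%N) // -(size_map mon_of) -monoms_triples.
Qed.

Lemma mon3E r s t : [/\ mon3 r s t 0 = r, mon3 r s t 1 = s & mon3 r s t 2%:R = t].
Proof. by split. Qed.

Lemma mon_ofP (m : 'X_{1..3}) t :
  m 0 = t.1.1 -> m 1 = t.1.2 -> m 2%:R = t.2 -> m = mon_of t.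
Proof.
case: t => [[a b] c] /= m0 m1 m2; have [E0 E1 E2] := mon3E a b c.
by apply/mnmP; apply: ord3P; rewrite ?m0 ?m1 ?m2 /mon_of /= ?E0 ?E1 ?E2.
Qed.

Lemma mon_of_inj : injective mon_of.
Proof.
case=> [[a b] c] [[a' b'] c'] E.
have [A0 A1 A2] := mon3E a b c; have [B0 B1 B2] := mon3E a' b' c'.
by rewrite -A0 -A1 -A2 -B0 -B1 -B2 -/(mon_of (a, b, c)) E.
Qed.

Lemma mon_of_map g t i : mon_of (map_expo g t) i = g i (mon_of t i).
Proof.
case: t => [[a b] c]; have [A0 A1 A2] := mon3E a b c.
have [B0 B1 B2] := mon3E (g 0 a)%N (g 1 b)%N (g 2 c)%N.
by move: i; apply: ord3P; rewrite /mon_of /= ?A0 ?A1 ?A2 ?B0 ?B1 ?B2.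
Qed.

Lemma mon_of_expo t (i : 'I_3) : mon_of t i = expo i t.
Proof.
case: t => [[a b] c]; have [A0 A1 A2] := mon3E a b c.
by move: i; apply: ord3P; rewrite /mon_of /= ?A0 ?A1 ?A2.
Qed.

Lemma mcoeff_tform l t : (tform l)@_(mon_of t) = tcoef l t.
Proof.
rewrite /tform raddf_sum /=; elim: l => [|x l IH]; first by rewrite big_nil.
rewrite big_cons IH /= mcoeffZ mcoeffX (inj_eq mon_of_inj).
by case: eqP => _; rewrite ?mulr1 ?mulr0.
Qed.

Lemma tform_cat l l' : tform (l ++ l') = tform l + tform l'.
Proof. exact: big_cat. Qed.

Lemma tform_opp l : tform (topp l) = - tform l.
Proof.
by rewrite /tform big_map -sumrN; apply: eq_bigr => x _; rewrite scaleNr.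
Qed.

Lemma tform_mul l l' : tform (tmul l l') = tform l * tform l'.
Proof.
rewrite /tform big_allpairs_dep mulr_suml; apply: eq_bigr => x _ /=.
rewrite mulr_sumr; apply: eq_bigr => y _.
rewrite -scalerAl -scalerAr scalerA -mpolyXD; congr (_ *: 'X_[_]).
have [A0 A1 A2] := mon3E x.2.1.1 x.2.1.2 x.2.2; have [B0 B1 B2] := mon3E y.2.1.1 y.2.1.2 y.2.2.
by symmetry; apply: mon_ofP; rewrite mnmDE /mon_of /= ?A0 ?A1 ?A2 ?B0 ?B1 ?B2.
Qed.

Lemma tform_det N :
  tform (tdet N) = \det (\matrix_(i < 3, j < 3) tform (N i j)).
Proof.
by rewrite det33 !mxE !(tform_cat, tform_mul, tform_opp) addrA.
Qed.

Lemma tform_deriv l (i : 'I_3) : (tform l)^`M(i) = tform (tderiv i l).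
Proof.
rewrite /tform raddf_sum /= /tderiv big_map big_filter [RHS]big_mkcond /=.
apply: eq_bigr => x _; rewrite linearZ /= mderivX mon_of_expo.
case: eqP => [->|_] /=; first by rewrite scale0r scaler0.
rewrite scalerA mulr_natr; congr (_ *: 'X_[_]).
by apply/mnmP => k; rewrite mnmBE mon_of_map mnm1E.
Qed.

(** Finitely many exponents suffice, since both coefficients are zero at an exponent that occurs in
    neither list. *)
Lemma tform_eq l l' : all (fun x => tcoef l x.2 == tcoef l' x.2) (l ++ l') -> tform l = tform l'.
Proof.
move=> /allP ll; apply/mpolyP => m; have [t ->] : exists t, m = mon_of t.
  by exists (m 0, m 1, m 2%:R); apply: mon_ofP.
rewrite !mcoeff_tform.
have z (k : seq term) : t \notin [seq x.2 | x <- k] -> tcoef k t = 0.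
  elim: k => //= x k IH; rewrite inE negb_or eq_sym => /andP[/negPf -> /IH ->].
  by rewrite addr0.
have [/mapP[x xl ->]|tl] := boolP (t \in [seq x.2 | x <- l ++ l']).
  by apply/eqP/ll.
by move: tl; rewrite map_cat mem_cat negb_or => /andP[/z -> /z ->].
Qed.

Definition coef_vector (l : seq term) (k : 'I_28) : int :=
  tcoef l (nth (0, 0, 0)%N (triples 6) k).

Lemma sextic_coef_vector l : all (fun x => sumn [:: x.2.1.1; x.2.1.2; x.2.2] == 6)%N l ->
  sextic (coef_vector l) = tform l.
Proof.
move=> /allP l6; have lh : tform l \is 6.-homog.
  rewrite /tform big_seq; apply: rpred_sum => x /l6 x6; apply: dhomogZ.
  rewrite dhomogX /= mdegE sum3; have [-> -> ->] := mon3E x.2.1.1 x.2.1.2 x.2.2.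
  by move: x6; rewrite /= addn0 addnA.
rewrite [RHS](homog_monoms lh) (big_nth 0%MM) size_monoms6 big_mkord.
by apply: eq_bigr => k _; rewrite nth_monoms ?size_monoms6 // mcoeff_tform.
Qed.

(** The computed factors are not compared with the canonical ones: the check [tfactor_ok] shows that
    they satisfy the gradient identity, and the determinant is independent of the choice. *)
Lemma sextic_disc_compute l :
  all (fun x => sumn [:: x.2.1.1; x.2.1.2; x.2.2] == 6)%N l ->
  all (fun m => all (tfactor_ok l m) (iota 0 3)) (triples 4) ->
  sextic_disc (coef_vector l) = \det (\matrix_(i < 45, j < 45) tsylvester l i j).
Proof.
move=> l6 /allP lok; have fE := sextic_coef_vector l6.
pose M (m : 'X_{1..3}) : 'M[{mpoly int[3]}]_3 :=
  \matrix_(i, j) tform (tfactor l (m 0, m 1, m 2%:R) i j).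
rewrite -(@sextic_discE _ _ M) => [|m m4 i]; last first.
  have mE : m = mon_of (m 0, m 1, m 2%:R) by apply: mon_ofP.
  have /lok/allP/(_ i) : (m 0, m 1, m 2%:R) \in triples 4.
    by rewrite -(mem_map mon_of_inj) -mE -monoms_triples mem_monoms m4.
  rewrite mem_iota /= => /(_ (ltn_ord i)) /tform_eq; rewrite fE tform_deriv => <-.
  rewrite !mxE !tform_cat !tform_mul addrA.
  have pw (j : 'I_3) : 'X_j ^+ (m j).+1 = tform
      [:: (1, map_expo (fun k _ => if k == j then (m j).+1 else 0%N) (m 0, m 1, m 2%:R))].
    rewrite /tform big_seq1 scale1r mpolyXn; congr 'X_[_]; apply/mnmP => k.
    by rewrite mon_of_map mulmnE mnm1E eq_sym val_eqE; case: eqP; rewrite ?mul1n ?mul0n.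
  by rewrite !pw.
rewrite sylvester_coefmx; congr (\det _); apply/matrixP => i j; rewrite !mxE fE.
rewrite nth_monoms ?size_monoms8 // /tsylvester -mcoeff_tform; congr mcoeff.
rewrite /sylcol /tsylcol; case: ltnP => j30.
  rewrite tform_mul nth_monoms ?size_monoms3 ?ltn_mod // tform_deriv inordK; last by lia.
  by rewrite /tform big_seq1 scale1r.
rewrite tform_det nth_monoms ?size_monoms4; last by have := ltn_ord j; lia.
by congr (\det _); apply/matrixP => a b; rewrite !mxE.
Qed.

Lemma perm_of_seq n (s : seq nat) : size s = n.+1 -> uniq s -> all (fun k => k < n.+1)%N s ->
  exists p : 'S_n.+1, forall i, p i = nth 0%N s i :> nat.
Proof.
move=> sn us /allP sn'; have slt (i : 'I_n.+1) : (nth 0%N s i < n.+1)%N.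
  by apply/sn'/mem_nth; rewrite sn.
have inj : injective (fun i : 'I_n.+1 => Ordinal (slt i)).
  move=> i j /(congr1 val) /= /eqP; rewrite nth_uniq ?sn // => /eqP; exact: val_inj.
by exists (perm inj) => i; rewrite permE.
Qed.

Lemma absz_det_triangular n (A : nat -> nat -> int) (s t : seq nat) :
  size s = n.+1 -> uniq s -> all (fun k => k < n.+1)%N s ->
  size t = n.+1 -> uniq t -> all (fun k => k < n.+1)%N t ->
  all (fun j => all (fun i => A (nth 0%N s i) (nth 0%N t j) == 0) (iota 0 j)) (iota 0 n.+1) ->
  `|\det (\matrix_(i < n.+1, j < n.+1) A i j)|%N =
  (\prod_(i < n.+1) `|A (nth 0%N s i) (nth 0%N t i)|)%N.
Proof.
move=> s1 s2 s3 t1 t2 t3 /allP A0.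
have [p pE] := perm_of_seq s1 s2 s3; have [q qE] := perm_of_seq t1 t2 t3.
set N := \matrix_(i, j) _.
have -> : `|\det N|%N = `|\det (row_perm p (col_perm q N))|%N.
  rewrite row_permE col_permE !det_mulmx !det_perm !abszM !abszX.
  by rewrite abszN1 !exp1n mul1n muln1.
rewrite det_trig => [|]; last first.
  apply/is_trig_mxP => i j ij; rewrite !mxE pE qE; apply/eqP.
  have jn : (j : nat) \in iota 0 n.+1 by rewrite mem_iota ltn_ord.
  have /allP Aj := A0 _ jn; apply: Aj; by rewrite mem_iota.
rewrite (big_morph absz abszM (erefl : `|1%:Z|%N = 1%N)).
by apply: eq_bigr => i _; rewrite !mxE pE qE.
Qed.

(* The lists s and t reorder the rows and the columns so that the matrix becomes triangular, with
   diagonal entries +- p^(a_i) q^(b_i). *)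
Lemma absz_sextic_disc (l : seq term) (s t a b : seq nat) (p q : nat) :
  all (fun x => sumn [:: x.2.1.1; x.2.1.2; x.2.2] == 6)%N l ->
  all (fun m => all (tfactor_ok l m) (iota 0 3)) (triples 4) ->
  [&& size s == 45, uniq s & all (fun k => k < 45) s]%N ->
  [&& size t == 45, uniq t & all (fun k => k < 45) t]%N ->
  all (fun j => all (fun i => tsylvester l (nth 0%N s i) (nth 0%N t j) == 0) (iota 0 j))
    (iota 0 45) ->
  (size a == 45%N) && (size b == 45%N) ->
  all (fun i => `|tsylvester l (nth 0%N s i) (nth 0%N t i)|%N
    == p ^ nth 0 a i * q ^ nth 0 b i)%N (iota 0 45) ->
  `|sextic_disc (coef_vector l)|%N = (p ^ sumn a * q ^ sumn b)%N.
Proof.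
move=> l6 lok /and3P[/eqP s1 s2 s3] /and3P[/eqP t1 t2 t3] ltri /andP[/eqP a1 /eqP b1] /allP ld.
rewrite sextic_disc_compute // (absz_det_triangular s1 s2 s3 t1 t2 t3 ltri).
rewrite (eq_bigr (fun i : 'I_45 => p ^ nth 0 a i * q ^ nth 0 b i)%N) => [|i _]; last first.
  by apply/eqP/ld; rewrite mem_iota ltn_ord.
rewrite big_split /= -!expn_sum.
by rewrite !sumnE (big_nth 0%N) a1 big_mkord (big_nth 0%N) b1 big_mkord.
Qed.

Definition fermat : seq term := [:: (1, (6, 0, 0)%N); (1, (0, 6, 0)%N); (1, (0, 0, 6)%N)].

Definition chain : seq term := [:: (1, (5, 1, 0)%N); (1, (0, 5, 1)%N); (1, (0, 0, 6)%N)].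


(** Each column is a multiple of a single monomial: the first 30 give 6 times an octic with an
    exponent at least 5, the last 15 give 6^3 times an octic with all exponents at most 4. Hence 30
    + 45 = 75. *)
Lemma sextic_disc_fermat : `|sextic_disc (coef_vector fermat)|%N = (6 ^ 75)%N.
Proof.
rewrite (@absz_sextic_disc fermat (iota 0 45)
  [:: 20; 21; 22; 23; 44; 10; 11; 12; 13; 24; 25; 26; 43; 42; 14; 15; 16; 27; 28; 41; 40; 39;
      17; 18; 29; 38; 37; 36; 35; 19; 34; 33; 32; 31; 30; 0; 1; 2; 3; 4; 5; 6; 7; 8; 9]%N
  [:: 1; 1; 1; 1; 3; 1; 1; 1; 1; 1; 1; 1; 3; 3; 1; 1; 1; 1; 1; 3; 3; 3;
      1; 1; 1; 3; 3; 3; 3; 1; 3; 3; 3; 3; 3; 1; 1; 1; 1; 1; 1; 1; 1; 1; 1]%N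
  (nseq 45 0%N) 6 1); [|by vm_compute..].
by rewrite exp1n muln1; congr (_ ^ _)%N.
Qed.

Lemma sextic_disc_chain : `|sextic_disc (coef_vector chain)|%N = (6 ^ 21 * 5 ^ 45)%N.
Proof.
(* In order: rows, columns, exponents of 6 and exponents of 5 on the diagonal. The exponents sum to
   21 and 45. *)
rewrite (@absz_sextic_disc chain
  [:: 0; 1; 2; 5; 6; 7; 8; 3; 9; 10; 12; 14; 15; 16; 11; 17; 19; 20; 22; 23; 18; 24; 25; 26;
      27; 29; 30; 31; 32; 33; 34; 35; 4; 36; 37; 38; 39; 13; 40; 41; 42; 21; 43; 44; 28]%N
  [:: 20; 21; 22; 11; 12; 13; 23; 43; 24; 25; 40; 15; 16; 26; 41; 27; 37; 36; 18; 28; 38; 29;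
      33; 32; 31; 34; 44; 0; 1; 2; 3; 10; 42; 4; 5; 6; 14; 39; 7; 8; 17; 35; 9; 19; 30]%N
  [:: 1; 1; 1; 0; 0; 0; 0; 1; 1; 1; 1; 0; 0; 0; 1; 1; 1; 1; 0; 0; 1; 1; 1; 1;
      1; 0; 1; 0; 0; 0; 0; 0; 1; 0; 0; 0; 0; 1; 0; 0; 0; 1; 0; 0; 1]%N
  [:: 0; 0; 0; 1; 1; 1; 0; 2; 0; 0; 2; 1; 1; 0; 2; 0; 2; 2; 1; 0; 2; 0; 2; 2;
      2; 2; 1; 1; 1; 1; 1; 0; 2; 1; 1; 1; 0; 2; 1; 1; 0; 2; 1; 0; 2]%N 6 5); [|by vm_compute..].
by congr (_ ^ _ * _ ^ _)%N.
Qed.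

(** * Comparison with the discriminant *)

Definition generic_disc : {mpoly int[28]} := sextic_disc (fun k => 'X_k).

Lemma evalZ_generic_disc (B : comNzRingType) (v : 'I_28 -> B) :
  evalZ v generic_disc = sextic_disc v.
Proof.
rewrite /generic_disc (map_sextic_disc (evalZ v)); apply: eq_sextic_disc => k.
exact: evalZX.
Qed.

Lemma map_generic_disc (R : comNzRingType) :
  map_mpoly intr generic_disc = sextic_disc (fun k : 'I_28 => 'X_k : {mpoly R[28]}).
Proof.
rewrite /generic_disc map_sextic_disc; apply: eq_sextic_disc => k.
by rewrite /= map_mpolyX.
Qed.

Lemma sextic_disc_intr (B : comNzRingType) (v : 'I_28 -> int) :
  sextic_disc (fun k => (v k)%:~R : B) = (sextic_disc v)%:~R.
Proof. by rewrite (map_sextic_disc (intr : {rmorphism int -> B})). Qed.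

Lemma tform_meval_x (B : comNzRingType) (l : seq term) :
  all (fun x => 0 < x.2.1.2 + x.2.2)%N l ->
  (map_mpoly intr (tform l)).@[fun i : 'I_3 => (i == 0)%:R : B] = 0.
Proof.
move=> /allP lp; rewrite /tform (rmorph_sum (map_mpoly intr)) (rmorph_sum (meval _)) /=.
rewrite big_seq big1 //= => x /lp x_gt0.
rewrite map_mpolyZ map_mpolyX mevalZ mevalX.
suff -> : \prod_(i < 3) ((i == 0)%:R : B) ^+ (mon_of x.2 i) = 0 by rewrite mulr0.
rewrite !big_ord_recl big_ord0 /= mulr1 !mon_of_expo /= !expr0n.
case: eqP => [e1|_]; last by rewrite mul0r mulr0.
case: eqP => [e2|_]; last by rewrite !mulr0.
by rewrite e1 e2 in x_gt0.
Qed.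

(** If every term has order at least two in y and z, the form and its derivatives vanish at (1 : 0 :
    0). *)
Lemma singular_at_x (B : comNzRingType) (l : seq term) :
  all (fun x => sumn [:: x.2.1.1; x.2.1.2; x.2.2] == 6)%N l ->
  all (fun x => 1 < x.2.1.2 + x.2.2)%N l ->
  singular_curve (sextic (fun k => (coef_vector l k)%:~R : B)).
Proof.
move=> l6 l2; rewrite -(map_sextic (intr : {rmorphism int -> B})) sextic_coef_vector //.
exists (fun i => (i == 0)%:R); split.
- by exists 0; rewrite eqxx oner_neq0.
- by apply: tform_meval_x; apply: sub_all l2 => x /ltnW.
move=> i; rewrite map_mderiv tform_deriv; apply: tform_meval_x.
apply/allP => y /mapP[x]; rewrite mem_filter => /andP[_ /(allP l2)] x2 ->.
by move: x2; case: (nat_of_ord i) => [|[|[|?]]] /=; lia.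
Qed.

Section Main.
Variables (R : realType) (D : {mpoly int[28]}).
Hypothesis D_disc : is_discriminant R D.
Local Notation C := (R[i]).

Lemma discriminant_zero (v : 'I_28 -> C) : (exists k, v k != 0) ->
  evalZ v D = 0 <-> singular_curve (sextic v).
Proof. by have [_ _ DP] := D_disc; apply: DP. Qed.

Lemma discriminant_zero_disc (v : 'I_28 -> C) : evalZ v D = 0 -> sextic_disc v = 0.
Proof.
move=> Dv; apply: singular_sextic_disc.
have [vn0|v0] := pselect (exists k, v k != 0); first exact/discriminant_zero.
(* [is_discriminant] speaks only of nonzero coefficient vectors; the zero form, given by the empty
   list, is singular at (1 : 0 : 0) as well. *)
have -> : v = (fun k => (coef_vector [::] k)%:~R).
  apply/funext => k; apply/eqP/negP => vk; case: v0; exists k; apply/negP => vk0.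
  by apply: vk; rewrite (eqP vk0).
exact: singular_at_x.
Qed.

(** The Fermat sextic without x^6: over the complex numbers, six lines through (1 : 0 : 0). *)
Definition yz6 : seq term := [:: (1, (0, 6, 0)%N); (1, (0, 0, 6)%N)].

(** The last unknown is the coefficient of x^6. If [D] did not involve it, [D] would take the same
    value at the Fermat sextic as at the singular [yz6], namely 0, against [sextic_disc_fermat]. *)
Lemma discriminant_size_muni : (1 < size (muni D))%N.
Proof.
rewrite ltnNge; apply/negP => /size1_polyC uD.
pose vF (k : 'I_28) : C := (coef_vector fermat k)%:~R.
pose v0 (k : 'I_28) : C := (coef_vector yz6 k)%:~R.
pose w (k : 'I_27) : C := vF (lift ord_max k).
have EF : vF = extend_point w (vF ord_max).
  apply/funext => k; rewrite /extend_point; case: unliftP => [j ->|->] //.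
have E0 : v0 = extend_point w 0.
  apply/funext => k; rewrite /extend_point; case: unliftP => [j ->|->] /=.
    congr (_%:~R); rewrite /coef_vector lift_max.
    have /allP/(_ j) : all (fun k => tcoef yz6 (nth (0, 0, 0)%N (triples 6) k)
      == tcoef fermat (nth (0, 0, 0)%N (triples 6) k)) (iota 0 27) by vm_compute.
    by rewrite mem_iota ltn_ord => /(_ isT)/eqP.
  by rewrite /v0 /coef_vector (_ : tcoef _ _ = 0) //; vm_compute.
have DF0 : evalZ vF D = evalZ v0 D.
  by rewrite EF E0 !evalZ_extend uD !map_polyC !hornerC.
have Fn0 : sextic_disc vF != 0.
  rewrite sextic_disc_intr intr_eq0 -absz_eq0 sextic_disc_fermat.
  by rewrite expn_eq0.
case/eqP: Fn0; apply: discriminant_zero_disc; rewrite DF0.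
apply/discriminant_zero; last exact: singular_at_x.
(* The first monomial is z^6, whose coefficient in [yz6] is 1. *)
exists ord0; rewrite /v0 /coef_vector (_ : tcoef _ _ = 1) ?oner_neq0 //; vm_compute.
Qed.

Lemma generic_disc_multiple : exists h, generic_disc = 6%:R ^+ 21 * (h * D).
Proof.
have [E EE] := sextic_disc_content (fun k : 'I_28 => 'X_k : {mpoly int[28]}).
have [Dirr _ _] := D_disc.
have [|h hE] := @hypersurface_dvd C 27 D E Dirr discriminant_size_muni.
  (* In characteristic zero the factor 6^21 can be cancelled, so the vanishing passes to [E]. *)
  move=> v /discriminant_zero_disc; rewrite -evalZ_generic_disc /generic_disc EE.
  rewrite rmorphM rmorphXn rmorph_nat => /eqP; rewrite mulf_eq0 expf_eq0 /=.
  by rewrite Num.Theory.pnatr_eq0 /= => /eqP.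
by exists h; rewrite -hE.
Qed.

End Main.

Lemma dhomog_msizeE (A : comNzRingType) n (p : {mpoly A[n]}) d :
  p != 0 -> p \is d.-homog -> msize p = d.+1.
Proof.
move=> p0 pd; have := dhomog_uniq p0 pd (dhomog_msize pd) => ->.
by rewrite prednK // lt0n msize_poly_eq0.
Qed.

Lemma eq1_of_coprime_multiples (c k x y p q : nat) : (0 < c)%N -> coprime p q ->
  (c * (k * x) = c * p -> c * (k * y) = c * q -> k = 1)%N.
Proof.
move=> c0 pq /eqP; rewrite eqn_pmul2l // => /eqP kx /eqP; rewrite eqn_pmul2l // => /eqP ky.
by apply/eqP; rewrite -dvdn1 -(eqP pq) dvdn_gcd -kx -ky !dvdn_mulr.
Qed.

Lemma generic_disc_eq (R : realType) (D : {mpoly int[28]}) : is_discriminant R D ->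
  exists b : bool, generic_disc = (-1) ^+ b * 6%:R ^+ 21 * D.
Proof.
move=> D_disc; have [h hE] := generic_disc_multiple D_disc.
have [_ D75 _] := D_disc.
have g75 : generic_disc \is 75.-homog := sextic_disc_homog int.
have val (v : 'I_28 -> int) : sextic_disc v = 6%:R ^+ 21 * (evalZ v h * evalZ v D).
  rewrite -evalZ_generic_disc hE (rmorphM (evalZ v)) (rmorphM (evalZ v)).
  by rewrite (rmorphXn (evalZ v)) (rmorph_nat (evalZ v)).
have g0 : generic_disc != 0.
  have : sextic_disc (coef_vector fermat) != 0 by rewrite -absz_eq0 sextic_disc_fermat expn_eq0.
  by apply: contraNneq => g0; rewrite -evalZ_generic_disc g0 rmorph0.
have hD0 : h * D != 0 by apply: contra_neq g0 => hD0; rewrite hE hD0 mulr0.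
have [h0 D0] : h != 0 /\ D != 0 by move: hD0; rewrite mulf_eq0 negb_or => /andP.
have c0 : (6%:R ^+ 21 : int) != 0 by rewrite expf_neq0.
have cE : 6%:R ^+ 21 = (6%:R ^+ 21 : int)%:MP :> {mpoly int[28]}.
  by rewrite rmorphXn rmorph_nat.
(* Both [generic_disc] and [D] have degree 75, and [msize] is the degree plus one, whence the 76 and
   a constant [h]. *)
have sh : msize h = 1%N.
  have := dhomog_msizeE g0 g75; rewrite hE cE mul_mpolyC msizeZ // msizeM //.
  rewrite (dhomog_msizeE D0 D75).
  have aux (a : nat) : ((a + 76).-1 = 76 -> a = 1)%N by lia.
  exact: aux.
have /msize_poly1P[k k0 hk] : msize h == 1%N by apply/eqP.
have abs_val (v : 'I_28 -> int) :
    `|sextic_disc v|%N = (6 ^ 21 * (`|k| * `|evalZ v D|))%N.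
  have vk : evalZ v k%:MP = k by rewrite /evalZ /= map_mpolyC mevalC; apply: intz.
  by rewrite val hk vk abszM abszX abszM.
(* After removal of 6^21 from the two explicit values, [k] divides both 5^45 and 6^54, which are
   coprime. *)
have k1 : `|k|%N = 1%N.
  apply: (@eq1_of_coprime_multiples (6 ^ 21) _ `|evalZ (coef_vector chain) D|
    `|evalZ (coef_vector fermat) D| (5 ^ 45) (6 ^ 54)).
  - by rewrite expn_gt0.
  - by apply: coprimeXl; apply: coprimeXr.
  - by rewrite -abs_val sextic_disc_chain.
  by rewrite -abs_val sextic_disc_fermat -expnD; congr (_ ^ _)%N.
have [b kE] : exists b : bool, k = (-1) ^+ b.
  by exists (k < 0)%R; move: k1; rewrite {1}[k]intEsign; case: k {k0 hk abs_val} => [[|[|n]]|[|n]].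
have kMP : k%:MP = (-1) ^+ b :> {mpoly int[28]}.
  by rewrite kE (rmorphXn (@mpolyC 28 int)) (rmorphN1 (@mpolyC 28 int)).
exists b; rewrite hE hk kMP; move: (6%:R ^+ 21) => c.
by rewrite mulrCA mulrA.
Qed.

Theorem proposition4p1 (R : realType) (D : {mpoly int[28]})
    (D_disc : is_discriminant R D)
    (M : 'X_{1..3} -> 'M[{mpoly {mpoly R[28]}[3]}]_3)
    (M_adm : forall m : 'X_{1..3}, mdeg m = 4%N ->
      admissible (general_sextic R) m (M m)) :
  exists b : bool,
    \det (sylvester_matrix (general_sextic R) M)
      = (-1) ^+ b * 6 ^+ 21 * map_mpoly intr D.
Proof.
have [b gE] := generic_disc_eq D_disc; exists b.
(* Every admissible family has the determinant of the canonical one, which is the image of the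
   integral polynomial [generic_disc]. *)
rewrite sextic_discE => [|m m4]; last by apply: admissible_grad_factor; apply: M_adm.
rewrite -map_generic_disc gE !rmorphM !rmorphXn rmorphN1 rmorph_nat.
by [].
Qed.
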